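(* Let $G=(V,E)$ be a directed graph (with a self-loop at every vertex) with maximum total degree $\Delta$, and let $\pi$ be a probability distribution on $V$ with $\pi_{\min}=\min_{v\in V}\pi(v)$. Then \[ \frac{1}{\vec{\psi}(G)}\cdot\frac{1}{\log(1/\pi_{\min})} \lesssim \tau^*(G) \lesssim \frac{1}{\vec{\psi}(G)^2}\cdot\log\frac{\Delta}{\vec{\psi}(G)}\cdot\log\frac{1}{\pi_{\min}}. \]
   Context: Notation: $f\lesssim g$ means $f\le c\,g$ for an absolute constant $c>0$. $\Delta$ is the maximum unweighted total degree (indegree plus outdegree) of a vertex. For $S\subseteq V$, $\overline S=V\setminus S$, $\pi(S)=\sum_{v\in S}\pi(v)$, $\partial^+(S)=\{v\notin S:\exists u\in S, uv\in E\}$; $\vec\psi(S)=\frac{\min\{\pi(\partial^+(S)),\pi(\partial^+(\overline S))\}}{\min\{\pi(S),\pi(\overline S)\}}$ and $\vec\psi(G)=\min_{\emptyset\neq S\subsetneq V}\vec\psi(S)$. For a row-stochastic matrix $P$ with stationary distribution $\pi$ and $\epsilon\in(0,1)$, the $\epsilon$-mixing time is $\tau_\epsilon(P)=\min\{t:\max_{p_0}\sum_{v}|(p_0P^t)(v)-\pi(v)|<\epsilon\}$, the max over initial probability distributions $p_0$ on $V$; $\tau(P)=\tau_{1/e}(P)$. The fastest mixing time $\tau^*(G)$ is the minimum of $\tau(P)$ over nonnegative $P\in\mathbb{R}^{V\times V}$ with $P(u,v)=0$ for $uv\notin E$, $\sum_v P(u,v)=1$ for all $u$, and $\sum_u\pi(u)P(u,v)=\pi(v)$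 for all $v$. Standing assumption: each vertex of $G$ has a self-loop. *)

(* Defs.v *)
From HB Require Import structures.
From mathcomp Require Import all_boot all_order all_algebra.
From mathcomp Require Import all_classical all_reals all_analysis.

Set Implicit Arguments.
Unset Strict Implicit.
Unset Printing Implicit Defensive.

Import Order.TTheory GRing.Theory Num.Theory.

Local Open Scope ring_scope.

(* A directed graph is a relation E on a finite type V, E u v meaning that uv
   is an edge.

   1/psi, log(1/pi_min) and the mixing times may be infinite (for instance when
   the graph is not strongly connected), so they live in \bar R, where
   0^-1 = +oo, (+oo)^-1 = 0, lne 0 = -oo, lne +oo = +oo and 0 * +oo = 0. *)

Section Digraph.
Variables (V : finType) (E : rel V).

(* A self-loop contributes 1 to the indegree and 1 to the outdegree. *)
Definition total_degree (v : V) : nat :=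
  (#|[set u | E u v]%SET| + #|[set u | E v u]%SET|)%N.

Definition max_total_degree : nat := (\max_(v : V) total_degree v)%N.

Definition out_boundary (S : {set V}) : {set V} :=
  [set v | (v \notin S) && [exists u in S, E u v]]%SET.

End Digraph.

Section Weighted.
Variables (R : realType) (V : finType).

Definition is_distribution (p : V -> R) : Prop :=
  (forall v, 0 <= p v) /\ \sum_v p v = 1.

Definition weight (pi : V -> R) (S : {set V}) : R := \sum_(v in S) pi v.

(* The minimum over the empty family is +oo; it only occurs for V empty. *)
Definition min_weight (pi : V -> R) : \bar R :=
  (\big[mine/+oo]_(v : V) (pi v)%:E)%E.

(* If the denominator is 0, then so is the numerator, since
   out_boundary E S is contained in ~: S and out_boundary E (~: S) in S;
   the quotient is then 0. For nonempty
   proper S this only occurs if pi vanishes somewhere. *)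
Definition set_vertex_expansion (E : rel V) (pi : V -> R) (S : {set V}) : R :=
  Num.min (weight pi (out_boundary E S)) (weight pi (out_boundary E (~: S)%SET))
  / Num.min (weight pi S) (weight pi (~: S)%SET).

(* The minimum over the empty family is +oo; it only occurs for #|V| <= 1. *)
Definition vertex_expansion (E : rel V) (pi : V -> R) : \bar R :=
  (\big[mine/+oo]_(S : {set V} | (S != finset.set0) && (S \proper finset.setT))
     (set_vertex_expansion E pi S)%:E)%E.

(* The row vector p P. *)
Definition step (P : V -> V -> R) (p : V -> R) : V -> R :=
  fun v => \sum_u p u * P u v.

(* The row vector p P^t. *)
Definition distribution_at (P : V -> V -> R) (p : V -> R) (t : nat) : V -> R :=
  iter t (step P) p.

(* A supremum attained by compactness of the simplex, hence a maximum. *)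
Definition worst_distance (P : V -> V -> R) (pi : V -> R) (t : nat) : \bar R :=
  ereal_sup [set (\sum_v `|distribution_at P p0 t v - pi v|)%:E
            | p0 in [set p0 | is_distribution p0]]%classic.

(* The infimum of a set of natural numbers is its minimum, or +oo if the set is
   empty, that is, if the chain never gets eps-close to pi. *)
Definition mixing_time_eps (eps : R) (P : V -> V -> R) (pi : V -> R) : \bar R :=
  ereal_inf [set (t%:R)%:E
            | t in [set t : nat | (worst_distance P pi t < eps%:E)%E]]%classic.

Definition mixing_time (P : V -> V -> R) (pi : V -> R) : \bar R :=
  mixing_time_eps (expR 1)^-1 P pi.

Definition admissible_transition (E : rel V) (pi : V -> R) (P : V -> V -> R)
    : Prop :=
  [/\ forall u v, 0 <= P u v,
      forall u v, ~~ E u v -> P u v = 0,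
      forall u, \sum_v P u v = 1 &
      forall v, \sum_u pi u * P u v = pi v].

(* An infimum of elements of nat or +oo, hence a minimum. *)
Definition fastest_mixing_time (E : rel V) (pi : V -> R) : \bar R :=
  ereal_inf [set mixing_time P pi
            | P in [set P | admissible_transition E pi P]]%classic.

End Weighted.

(* Main.v *)
Require Import Defs.
From mathcomp Require Import all_boot all_order all_algebra.
From mathcomp Require Import ring lra zify.
From mathcomp Require Import all_classical all_reals all_analysis.

Set Implicit Arguments.
Unset Strict Implicit.
Unset Printing Implicit Defensive.

Import Order.TTheory GRing.Theory Num.Theory.
Import numFieldNormedType.Exports.

(* Lower bound: started from [pi] conditioned on the lighter side of a cut [S],
   any admissible chain leaks at most [set_vertex_expansion S] of its mass per
   step, so it needs of order [1 / psi] steps to reach the other side.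

   Upper bound: it suffices to find a circulation [F] on the edges, with
   marginals [pi], whose Dirichlet form has spectral gap of order
   [psi^2 / ln (Delta / psi)]; the lazy chain of [F] then contracts the
   chi-square distance to [pi]. By a minimax argument such an [F] exists as soon
   as, for every mean-zero [f : V -> R^I] and all [a], [c] with
   [|f u - f v|^2 <= c v + a u - a v] on edges, the [pi]-mean of [c] is at least
   that gap times the variance of [f]. In dimension one the potentials
   [p^2 + K a], where [p] is the positive or the negative part of [f] and [K] is
   of order [1 / psi], increase along edges by an amount charged to the head of
   the edge only, so that a one-sided coarea inequality applies. Random signs
   reduce to dimension one at the cost of the factor [ln (Delta / psi)], which
   controls all in-neighbours of a vertex outside an event of probability
   [O(psi^2)]. *)

Local Open Scope ring_scope.

(** * One-sided coarea inequality *)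

(** The thresholds are the distinct values of [phi] in increasing order and [d k] is the gap above
    the k-th one, so the sum telescopes from the rank of [phi v] to that of [phi w]. *)
Lemma layer_cake (R : realDomainType) (V : finType) (phi : V -> R) :
  exists n (t d : nat -> R), (forall k, (k < n)%N -> 0 <= d k) /\
    forall v w, phi v <= phi w ->
      \sum_(k < n) d k *+ (phi v <= t k < phi w)%R = phi w - phi v.
Proof.
pose s := sort <=%R (undup (codom phi)).
have ss : sorted <%R s.
  by rewrite lt_sorted_uniq_le sort_uniq undup_uniq sort_le_sorted.
have ms v : phi v \in s by rewrite mem_sort mem_undup codom_f.
exists (size s).-1, (nth 0 s), (fun k => nth 0 s k.+1 - nth 0 s k); split.
  move=> k kn; have k1 : (k.+1 < size s)%N by rewrite -ltn_predRL.
  by rewrite subr_ge0 ltW// (lt_sorted_ltn_nth 0 ss) ?inE// (ltn_trans _ k1).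
move=> v w vw.
have iv : (index (phi v) s < size s)%N by rewrite index_mem.
have iw : (index (phi w) s < size s)%N by rewrite index_mem.
have ij : (index (phi v) s <= index (phi w) s)%N.
  by rewrite -(lt_sorted_leq_nth 0 ss) ?inE// !nth_index.
transitivity (\sum_(index (phi v) s <= k < index (phi w) s)
    (nth 0 s k.+1 - nth 0 s k)); last by rewrite telescope_sumr// !nth_index.
rewrite (@big_nat_widen _ _ _ _ _ (size s).-1); last by lia.
rewrite (@big_nat_widenl _ _ _ _ 0%N)//= [RHS]big_mkcond [RHS]big_mkord /=.
apply: eq_bigr => k _.
have ks : (k < size s)%N by rewrite (leq_trans (ltn_ord k)) ?leq_pred.
rewrite -{1}(nth_index 0 (ms v)) -{1}(nth_index 0 (ms w)).
rewrite (lt_sorted_leq_nth 0 ss) ?inE// (lt_sorted_ltn_nth 0 ss) ?inE//.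
by rewrite andbC; case: ifP.
Qed.

Lemma sum_indicator (R : pzRingType) (V : finType) (pi : V -> R) (P : pred V) :
  \sum_(v | P v) pi v = \sum_v pi v * (P v)%:R.
Proof. by rewrite big_mkcond; apply: eq_bigr => v _; rewrite mulr_natr mulrb. Qed.

Lemma weight_ge0 (R : realType) (V : finType) (pi : V -> R) (A : {set V}) :
  (forall v, 0 <= pi v) -> 0 <= weight pi A.
Proof. by move=> pi0; apply: sumr_ge0. Qed.

Lemma weight_gt0 (R : realType) (V : finType) (pi : V -> R) (A : {set V}) :
  (forall v, 0 < pi v) -> A != finset.set0 -> 0 < weight pi A.
Proof.
move=> pip /finset.set0Pn[v vA]; rewrite /weight (bigD1 v)//= ltr_pwDl ?pip//.
by rewrite sumr_ge0// => u _; exact: ltW.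
Qed.

Lemma distribution_inhabited (R : realType) (V : finType) (pi : V -> R) :
  is_distribution pi -> exists v : V, true.
Proof.
move=> [_ pi1]; apply/existsP; apply: contraT => /existsPn h.
move: pi1; rewrite big1 => [/eqP|v]; first by rewrite eq_sym oner_eq0.
by have := h v.
Qed.

(** Both sides are summed over the sublevel sets [S k] of [phi]. Weights are at most 1, so the
    product of the weights of [S k] and its complement is at most their minimum, which the
    out-boundary controls. A vertex [v] lies in that boundary for the thresholds between its lowest
    in-neighbour and itself, a range of length at most [w v] however many edges enter [v]. *)
Lemma coarea (R : realType) (V : finType) (E : rel V) (pi : V -> R)
    (psi : R) (phi w : V -> R) :
  reflexive E -> is_distribution pi -> 0 <= psi ->
  (forall S : {set V}, psi * Num.min (weight pi S) (weight pi (~: S))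
     <= weight pi (out_boundary E S)) ->
  (forall u v, E u v -> phi v - phi u <= w v) ->
  psi * (\sum_v \sum_u pi v * pi u * `|phi v - phi u|) <= 2 * \sum_v pi v * w v.
Proof.
move=> Er [pi0 pi1] psi0 hpsi hw.
have [n [t [d [d0 cake]]]] := layer_cake phi.
pose I v k : R := (phi v <= t k)%R%:R.
pose S k := [set v | phi v <= t k]%SET.
have weightS k : weight pi (S k) = \sum_v pi v * I v k.
  by rewrite /weight sum_indicator; apply: eq_bigr => v _; rewrite inE.
have weightSC k : weight pi (~: S k) = \sum_v pi v * (1 - I v k).
  rewrite /weight sum_indicator; apply: eq_bigr => v _; rewrite !inE /I.
  by case: (_ <= _); rewrite ?subrr ?subr0.
have cakeI v u : phi v <= phi u ->
    \sum_(k < n) d k * (I v k * (1 - I u k)) = phi u - phi v.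
  move=> vu; rewrite -cake//; apply: eq_bigr => k _; rewrite -mulr_natr /I ltNge.
  by case: (_ <= _); case: (_ <= _); rewrite /= ?(subrr, subr0, mulr0, mulr1, mul0r).
have cake0 v u : phi u <= phi v ->
    \sum_(k < n) d k * (I v k * (1 - I u k)) = 0.
  move=> uv; apply: big1 => k _; rewrite /I.
  case: (leP (phi v)) => [vt|_]; last by rewrite mul0r mulr0.
  by rewrite (le_trans uv vt) subrr !mulr0.
have absE v u : `|phi v - phi u| =
    \sum_(k < n) d k * (I v k * (1 - I u k) + I u k * (1 - I v k)).
  under eq_bigr do rewrite mulrDr.
  rewrite big_split /=; case: (leP (phi v) (phi u)) => [vu|/ltW uv].
    by rewrite (cakeI v u)// (cake0 u v)// addr0 distrC ger0_norm ?subr_ge0.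
  by rewrite (cakeI u v)// (cake0 v u)// add0r ger0_norm ?subr_ge0.
have pairE : \sum_v \sum_u pi v * pi u * `|phi v - phi u| =
    \sum_(k < n) d k * (2 * (weight pi (S k) * weight pi (~: S k))).
  under eq_bigr do under eq_bigr do rewrite absE mulr_sumr.
  under eq_bigr do rewrite exchange_big /=.
  rewrite exchange_big /=; apply: eq_bigr => k _.
  rewrite weightS weightSC mulr_natl mulr2n {1}mulr_suml {1}mulr_sumr.
  rewrite -big_split mulr_sumr /=; apply: eq_bigr => v _.
  rewrite mulr_sumr mulr_suml -big_split mulr_sumr /=; apply: eq_bigr => u _.
  ring.
(* The self-loop makes [v] itself a candidate, whence [phi (u0 v) <= phi v]. *)
pose u0 v := [arg min_(u < v | E u v) phi u]%O.
have [Eu0 u0_min] : (forall v, E (u0 v) v) /\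
    (forall u v, E u v -> phi (u0 v) <= phi u).
  by split=> [v|u v]; rewrite /u0; case: arg_minP => // x _ h Euv; exact: h.
have bdyS k : weight pi (out_boundary E (S k)) <=
    \sum_v pi v * (I (u0 v) k * (1 - I v k)).
  rewrite /weight sum_indicator; apply: ler_sum => v _.
  apply: ler_wpM2l => //; rewrite inE /I.
  case: (boolP (v \in S k)) => [|vS] /=; first by rewrite inE => ->; rewrite subrr mulr0.
  have := vS; rewrite inE => /negbTE ->; rewrite subr0 mulr1 ler_nat.
  case: existsP => // -[u /andP[uS Euv]].
  by move: uS; rewrite inE => /(le_trans (u0_min _ _ Euv)) ->.
have weight01 (A : {set V}) : 0 <= weight pi A <= 1.
  rewrite /weight sumr_ge0//= -pi1 [leRHS](bigID (mem A)) /= lerDl.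
  by rewrite sumr_ge0.
rewrite pairE [leLHS]mulr_sumr.
apply: (@le_trans _ _ (\sum_(k < n) d k *
    (2 * \sum_v pi v * (I (u0 v) k * (1 - I v k))))).
  apply: ler_sum => k _; rewrite mulrCA [psi * _]mulrCA.
  apply: ler_wpM2l; first exact: d0.
  apply: ler_wpM2l => //; apply: le_trans (bdyS k); apply: le_trans (hpsi _).
  apply: ler_wpM2l => //.
  have /andP[a0 a1] := weight01 (S k); have /andP[b0 b1] := weight01 (~: S k).
  by rewrite le_min ler_piMr// ler_piMl.
under eq_bigr do rewrite mulrCA mulr_sumr.
rewrite -mulr_sumr ler_wpM2l// exchange_big /=; apply: ler_sum => v _.
under eq_bigr do rewrite mulrCA.
rewrite -mulr_sumr ler_wpM2l// cakeI ?hw//.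
by apply: u0_min.
Qed.

(** * The one-dimensional inequality *)

(** The potential [p^2 + K a] rises along an edge into [v] by at most [w v]. At a good vertex the
    rise of [p^2] is split into [psi / 8 * p v ^+ 2] and a part below [K * (c v + a u - a v)], whose
    potential terms cancel against [K a]; at a bad vertex it is at most [p v ^+ 2]. A second use of
    [coarea], on [a] with charge [c], removes [K a]. *)
Lemma one_sided_bound (R : realType) (V : finType) (E : rel V) (pi : V -> R)
    (psi G : R) (h p a c : V -> R) (bad : pred V) :
  reflexive E -> is_distribution pi -> 0 < psi ->
  (forall S : {set V}, psi * Num.min (weight pi S) (weight pi (~: S))
     <= weight pi (out_boundary E S)) ->
  0 <= G ->
  (forall u v, E u v -> a v - a u <= c v) ->
  (forall u v, E u v -> ~~ bad v -> (h u - h v) ^+ 2 <= G * (c v + a u - a v)) ->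
  (forall v, 0 <= p v) ->
  (forall u v, (p u - p v) ^+ 2 <= (h u - h v) ^+ 2) ->
  psi * (\sum_v \sum_u pi v * pi u * `|p v ^+ 2 - p u ^+ 2|) <=
    2 * (\sum_v pi v * ((psi / 8 + (bad v)%:R) * p v ^+ 2)) +
    32 * G / psi * \sum_v pi v * c v.
Proof.
move=> Er pid psi0 hpsi G0 hac hgood p0 ph; have [pi0 pi1] := pid.
pose K := 8 * G / psi.
have K0 : 0 <= K by rewrite /K divr_ge0 ?mulr_ge0// ltW.
pose phi v := p v ^+ 2 + K * a v.
pose w v := (psi / 8 + (bad v)%:R) * p v ^+ 2 + K * c v.
have hw u v : E u v -> phi v - phi u <= w v.
  move=> Euv; rewrite /phi /w.
  have hKc : K * (a v - a u) <= K * c v by rewrite ler_wpM2l// hac.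
  case: (boolP (bad v)) => [_|nb].
    have := sqr_ge0 (p u); have := mulr_ge0 (ltW psi0) (sqr_ge0 (p v)).
    rewrite mulr1n; lra.
  have := le_trans (ph u v) (hgood _ _ Euv nb); rewrite mulr0n addr0 => hg.
  have hg2 : 8 / psi * (p u - p v) ^+ 2 <= K * (c v + a u - a v).
    rewrite (_ : K * _ = 8 / psi * (G * (c v + a u - a v))); last by rewrite /K; ring.
    by rewrite ler_wpM2l// divr_ge0// ltW.
  suff : p v ^+ 2 - p u ^+ 2 <= psi / 8 * p v ^+ 2 + 8 / psi * (p u - p v) ^+ 2.
    by move: hg2; lra.
  (* Scaled by [8 / psi], this is Young's inequality for [2 * p v * (p v - p u)]. *)
  have := sqr_ge0 (psi / 8 * p v - (p v - p u)).
  move/(ler_wpM2l (divr_ge0 (ler0n _ 8) (ltW psi0))).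
  rewrite mulr0 (_ : 8 / psi * (psi / 8 * _ - _) ^+ 2 = psi / 8 * p v ^+ 2 - 2 * p v * (p v - p u)
    + 8 / psi * (p u - p v) ^+ 2); last by rewrite !expr2; field; rewrite gt_eqF.
  have := sqr_ge0 (p v - p u).
  by rewrite !expr2; lra.
have hB := coarea Er pid (ltW psi0) hpsi hw.
have hA := coarea Er pid (ltW psi0) hpsi hac.
set C := \sum_v pi v * c v.
pose A := \sum_v \sum_u pi v * pi u * `|a v - a u|.
pose B := \sum_v \sum_u pi v * pi u * `|phi v - phi u|.
pose W := \sum_v pi v * w v.
rewrite -/A -/C in hA; rewrite -/B -/W in hB.
have WE : W = \sum_v pi v * ((psi / 8 + (bad v)%:R) * p v ^+ 2) + K * C.
  by rewrite /W /C mulr_sumr -big_split /=; apply: eq_bigr => v _; rewrite /w; ring.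
have hKA : K * (psi * A) <= K * (2 * C) by rewrite ler_wpM2l.
have tri : \sum_v \sum_u pi v * pi u * `|p v ^+ 2 - p u ^+ 2| <= B + K * A.
  rewrite /A /B mulr_sumr -big_split /=; apply: ler_sum => v _.
  rewrite mulr_sumr -big_split /=; apply: ler_sum => u _.
  rewrite (mulrCA K) -mulrDr ler_wpM2l ?mulr_ge0//.
  rewrite -{1}(ger0_norm K0) -normrM.
  have -> : p v ^+ 2 - p u ^+ 2 = phi v - phi u - K * (a v - a u).
    by rewrite /phi; ring.
  exact: ler_normB.
move/(ler_wpM2l (ltW psi0)): tri => tri.
apply: (le_trans tri).
have -> : 32 * G / psi = 4 * K by rewrite /K; ring.
by move: hB hKA; rewrite WE; lra.
Qed.

Lemma sum_pair_sqr (R : realType) (V : finType) (pi h : V -> R) :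
  is_distribution pi -> \sum_v pi v * h v = 0 ->
  \sum_v \sum_u pi v * pi u * (h v - h u) ^+ 2 = 2 * \sum_v pi v * h v ^+ 2.
Proof.
move=> [_ pi1] h0; set Q := \sum_v pi v * h v ^+ 2.
transitivity (\sum_v (pi v * h v ^+ 2 * (\sum_u pi u) + pi v * Q -
    2 * (pi v * h v) * (\sum_u pi u * h u))).
  apply: eq_bigr => v _.
  rewrite /Q !mulr_sumr -big_split -sumrB /=.
  by apply: eq_bigr => u _; ring.
under eq_bigr do rewrite h0 pi1 mulr0 subr0 mulr1.
by rewrite big_split /= -mulr_suml pi1 mul1r -mulr2n mulr_natl.
Qed.

(** For arguments of one sign, [(x - y)^2 <= |x^2 - y^2|]; the factor 2 pays for opposite signs,
    where [(x - y)^2 <= 2 (x^2 + y^2)]. *)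
Lemma sqr_sub_le_parts (R : realType) (x y : R) :
  (x - y) ^+ 2 <= 2 * (`|Num.max x 0 ^+ 2 - Num.max y 0 ^+ 2| +
                       `|Num.max (- x) 0 ^+ 2 - Num.max (- y) 0 ^+ 2|).
Proof.
wlog yx : x y / y <= x => [H|].
  have [/H//|/ltW xy] := leP y x.
  have := H _ _ xy; rewrite -sqrrN opprB.
  by rewrite (distrC (Num.max x 0 ^+ 2)) (distrC (Num.max (- x) 0 ^+ 2)).
have [y0|/ltW y0] := leP 0 y.
  have x0 : 0 <= x by exact: le_trans yx.
  rewrite (max_l x0) !(@max_r _ _ (- _)) ?oppr_le0// subrr normr0 addr0.
  have xy : 0 <= (x - y) * y by rewrite mulr_ge0 ?subr_ge0.
  have := ler_norm (x ^+ 2 - y ^+ 2); have := sqr_ge0 (x - y).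
  by rewrite !expr2; lra.
have [x0|/ltW x0] := leP 0 x.
  rewrite (@max_r _ _ (- x)) ?oppr_le0// (@max_l _ _ (- y)) ?oppr_ge0//.
  have := ler_norm (x ^+ 2 - 0 ^+ 2); have := ler_norm (- (0 ^+ 2 - (- y) ^+ 2)).
  have := sqr_ge0 (x + y).
  by rewrite normrN !expr2; lra.
rewrite !(@max_l _ _ (- _)) ?oppr_ge0// subrr normr0 add0r.
have xy : 0 <= (x - y) * - x by rewrite mulr_ge0 ?subr_ge0 ?oppr_ge0.
have := ler_norm (- ((- x) ^+ 2 - (- y) ^+ 2)); have := sqr_ge0 (x - y).
by rewrite normrN !expr2; lra.
Qed.

(** [one_sided_bound] is applied to the positive and the negative part of [h], both contractions of
    [h]. The factor 2 of [sqr_sub_le_parts] cancels that of [sum_pair_sqr], and the [psi / 8] terms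
    add up to [psi / 4] times the variance, which leaves [3 / 4] on the left. *)
Lemma one_dimensional_bound (R : realType) (V : finType) (E : rel V)
    (pi : V -> R) (psi G : R) (h a c : V -> R) (bad : pred V) :
  reflexive E -> is_distribution pi -> 0 < psi ->
  (forall S : {set V}, psi * Num.min (weight pi S) (weight pi (~: S))
     <= weight pi (out_boundary E S)) ->
  0 <= G ->
  (forall u v, E u v -> a v - a u <= c v) ->
  (forall u v, E u v -> ~~ bad v -> (h u - h v) ^+ 2 <= G * (c v + a u - a v)) ->
  \sum_v pi v * h v = 0 ->
  3 / 4 * psi * (\sum_v pi v * h v ^+ 2) <=
    2 * (\sum_v pi v * ((bad v)%:R * h v ^+ 2)) + 64 * G / psi * \sum_v pi v * c v.
Proof.
move=> Er pid psi0 hpsi G0 hac hgood h0; have [pi0 pi1] := pid.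
pose p v := Num.max (h v) 0; pose q v := Num.max (- h v) 0.
have maxE (x : R) : (0 <= x /\ Num.max x 0 = x /\ Num.max (- x) 0 = 0) \/
    (x <= 0 /\ Num.max x 0 = 0 /\ Num.max (- x) 0 = - x).
  have [x0|/ltW x0] := leP 0 x; [left|right]; split=> //.
    by rewrite max_r ?oppr_le0.
  by rewrite max_l ?oppr_ge0.
have hp := one_sided_bound (p := p) Er pid psi0 hpsi G0 hac hgood.
have hq := one_sided_bound (p := q) Er pid psi0 hpsi G0 hac hgood.
have {}hp := hp (fun v => ltac:(by rewrite le_max lexx orbT)).
have {}hq := hq (fun v => ltac:(by rewrite le_max lexx orbT)).
have contr u v : (p u - p v) ^+ 2 <= (h u - h v) ^+ 2 /\
    (q u - q v) ^+ 2 <= (h u - h v) ^+ 2.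
  rewrite /p /q; have [[hu [-> ->]]|[hu [-> ->]]] := maxE (h u);
  have [[hv [-> ->]]|[hv [-> ->]]] := maxE (h v);
  first [have := mulr_ge0 hu hv | have := mulr_le0 hu hv |
         have := mulr_ge0_le0 hu hv | have := mulr_le0_ge0 hu hv];
  have := sqr_ge0 (h u); have := sqr_ge0 (h v);
  have := sqr_ge0 (h u - h v); rewrite !expr2; split; lra.
have {}hp := hp (fun u v => (contr u v).1).
have {}hq := hq (fun u v => (contr u v).2).
have pqE v : p v ^+ 2 + q v ^+ 2 = h v ^+ 2.
  by rewrite /p /q; have [[hu [-> ->]]|[hu [-> ->]]] := maxE (h v); ring.
have pair : \sum_v pi v * h v ^+ 2 <=
    \sum_v \sum_u pi v * pi u * `|p v ^+ 2 - p u ^+ 2| +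
    \sum_v \sum_u pi v * pi u * `|q v ^+ 2 - q u ^+ 2|.
  rewrite -(@ler_pM2l _ 2)// -sum_pair_sqr//.
  rewrite -big_split mulr_sumr; apply: ler_sum => v _ /=.
  rewrite -big_split mulr_sumr; apply: ler_sum => u _ /=.
  rewrite -mulrDr [leRHS]mulrCA ler_wpM2l ?mulr_ge0//.
  exact: sqr_sub_le_parts.
have comb : \sum_v pi v * ((psi / 8 + (bad v)%:R) * p v ^+ 2) +
    \sum_v pi v * ((psi / 8 + (bad v)%:R) * q v ^+ 2) =
    psi / 8 * (\sum_v pi v * h v ^+ 2) + \sum_v pi v * ((bad v)%:R * h v ^+ 2).
  rewrite mulr_sumr -!big_split; apply: eq_bigr => v _ /=.
  by rewrite -pqE; ring.
move/(ler_wpM2l (ltW psi0)): pair; rewrite mulrDr.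
have -> : 64 * G / psi = 2 * (32 * G / psi) by ring.
move: hp hq comb; lra.
Qed.

(** * Random signs *)

Lemma expR1_ge (R : realType) : 16 / 7 <= expR 1 :> R.
Proof.
rewrite (_ : 1 = 4%:R * 4^-1 :> R); last by field.
rewrite expRM_natl; apply: (@le_trans _ _ ((1 + 4^-1) ^+ 4)); first by lra.
by rewrite ler_pXn2r ?nnegrE ?expR_ge0 ?expR_ge1Dx// addr_ge0 ?invr_ge0.
Qed.

Lemma expR_half_le2 (R : realType) : expR 2^-1 <= 2 :> R.
Proof.
have := expR_ge1Dx (- 2^-1 : R); rewrite expRN => h.
rewrite -[expR _]invrK -[leRHS]invrK lef_pV2 ?posrE ?invr_gt0 ?expR_gt0//.
by apply: le_trans h; lra.
Qed.

(** The sharp exponent is [t^2 / 2]; for [2 t^2] elementary bounds suffice. If [|t| <= 1/2], then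
    [expR (- x) <= 1 / (1 + x)] bounds the sum by [2 / (1 - t^2) <= 2 (1 + 2 t^2)]; otherwise
    [|t| <= 2 t^2]. *)
Lemma cosh_le_expR (R : realType) (t : R) :
  expR t + expR (- t) <= 2 * expR (2 * t ^+ 2).
Proof.
have tt : `|t| ^+ 2 = t ^+ 2 by rewrite real_normK ?num_real.
have [th|/ltW th] := leP `|t| 2^-1.
  have h : t ^+ 2 <= 4^-1.
    rewrite -tt (_ : 4^-1 = 2^-1 ^+ 2); last by field.
    by rewrite ler_pXn2r ?nnegrE ?invr_ge0.
  have tlt : -1 < t < 1.
    rewrite -ltr_norml -(@ltr_pXn2r _ 2)// ?nnegrE// expr1n real_normK ?num_real//.
    by apply: le_lt_trans h _; lra.
  have invE (x : R) : -1 < x -> expR (- x) <= (1 + x)^-1.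
    move=> x1; rewrite expRN lef_pV2 ?posrE ?expR_gt0//; last by lra.
    exact: expR_ge1Dx.
  have h1 := invE t; have h2 := invE (- t); rewrite opprK in h2.
  have := expR_ge1Dx (2 * t ^+ 2).
  have : (1 + t)^-1 + (1 - t)^-1 <= 2 * (1 + 2 * t ^+ 2).
    rewrite (_ : _ + _ = 2 / (1 - t ^+ 2)); last first.
      by rewrite !expr2; field; apply/and3P; split; rewrite ?gt_eqF//; move: h; rewrite ?expr2; lra.
    rewrite ler_pM2l// -[leRHS]invrK lef_pV2 ?posrE ?invr_gt0; try lra; last first.
      by have := sqr_ge0 t; lra.
    rewrite -[leLHS]mul1r ler_pdivrMr; last by have := sqr_ge0 t; lra.
    by have := sqr_ge0 t; nra.
  move: (h1 ltac:(lra)) (h2 ltac:(lra)); lra.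
have h : `|t| <= 2 * t ^+ 2.
  by rewrite -[leLHS]mul1r -tt expr2 mulrA ler_wpM2r//; lra.
have e1 : expR t <= expR (2 * t ^+ 2).
  by rewrite ler_expR (le_trans _ h)// ler_norm.
have e2 : expR (- t) <= expR (2 * t ^+ 2).
  by rewrite ler_expR (le_trans _ h)// -normrN ler_norm.
by move: e1 e2; lra.
Qed.

(** A Rademacher sum; [sign_mean] is the expectation under independent uniform signs. *)
Definition sign_sum (R : pzRingType) (I : finType) (x : I -> R)
  (g : {ffun I -> bool}) : R := \sum_i (-1) ^+ g i * x i.

Definition sign_mean (R : unitRingType) (I : finType) (X : {ffun I -> bool} -> R) : R :=
  (2 ^+ #|I|)^-1 * \sum_g X g.

Section SignMean.
Variables (R : numFieldType) (I : finType).
Implicit Types (X Y : {ffun I -> bool} -> R) (x : I -> R).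

Lemma eq_sign_mean X Y : X =1 Y -> sign_mean X = sign_mean Y.
Proof. by move=> XY; rewrite /sign_mean (eq_bigr _ (fun g _ => XY g)). Qed.

Lemma sign_mean_le X Y : (forall g, X g <= Y g) -> sign_mean X <= sign_mean Y.
Proof.
by move=> XY; rewrite ler_wpM2l ?invr_ge0 ?exprn_ge0//; apply: ler_sum => g _; exact: XY.
Qed.

Lemma sign_mean_cst (k : R) : sign_mean (fun _ : {ffun I -> bool} => k) = k.
Proof.
rewrite /sign_mean sumr_const card_ffun card_bool -[k *+ _]mulr_natl natrX mulrA.
by rewrite mulVf ?mul1r// expf_neq0// pnatr_eq0.
Qed.

Lemma sign_meanD X Y : sign_mean (fun g => X g + Y g) = sign_mean X + sign_mean Y.
Proof. by rewrite /sign_mean big_split mulrDr. Qed.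

Lemma sign_meanZ (k : R) X : sign_mean (fun g => k * X g) = k * sign_mean X.
Proof. by rewrite /sign_mean -mulr_sumr mulrCA. Qed.

Lemma sign_mean_sum (J : Type) (r : seq J) (P : pred J) (F : J -> {ffun I -> bool} -> R) :
  sign_mean (fun g => \sum_(j <- r | P j) F j g) = \sum_(j <- r | P j) sign_mean (F j).
Proof. by rewrite /sign_mean exchange_big mulr_sumr. Qed.

(** Flipping the [i]-th sign permutes the sign vectors and negates the summand. *)
Lemma sign_mean_cross (i j : I) : i != j ->
  sign_mean (fun g : {ffun I -> bool} => (-1) ^+ g i * (-1) ^+ g j : R) = 0.
Proof.
move=> ij; pose flip (g : {ffun I -> bool}) := [ffun k => if k == i then ~~ g k else g k].
have flipK : involutive flip.
  by move=> g; apply/ffunP => k; rewrite !ffunE; case: eqP => //; rewrite negbK.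
rewrite /sign_mean; set s := \sum_g _; suff -> : s = 0 by rewrite mulr0.
suff : s = - s by move/eqP; rewrite -addr_eq0 -mulr2n mulrn_eq0 /= => /eqP.
rewrite {1}/s (reindex_inj (inv_inj flipK)) /= -sumrN; apply: eq_bigr => g _.
rewrite !ffunE eqxx (eq_sym j) (negbTE ij).
by case: (g i); rewrite /= ?expr0 ?expr1 ?mulN1r ?mul1r ?opprK.
Qed.

Lemma sign_mean_sqr x : sign_mean (fun g => sign_sum x g ^+ 2) = \sum_i x i ^+ 2.
Proof.
under eq_sign_mean.
  move=> g; rewrite expr2 /sign_sum mulr_suml.
  under eq_bigr do rewrite mulr_sumr.
  over.
rewrite sign_mean_sum; apply: eq_bigr => i _.
rewrite sign_mean_sum (bigD1 i)//= [X in _ + X]big1 ?addr0 => [|j ji].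
  under eq_sign_mean do rewrite -expr2 exprMn sqrr_sign mul1r.
  exact: sign_mean_cst.
under eq_sign_mean do rewrite mulrACA mulrC.
by rewrite sign_meanZ sign_mean_cross ?mulr0// eq_sym.
Qed.

End SignMean.

Section SignTail.
Variables (R : realType) (I : finType).
Implicit Types x : I -> R.

Lemma sign_sumZ (s : R) x g : sign_sum (fun i => s * x i) g = s * sign_sum x g.
Proof. by rewrite /sign_sum mulr_sumr; apply: eq_bigr => i _; rewrite mulrCA. Qed.

(** By independence the exponential moment is the product over [i] of the hyperbolic cosines of
    [x i]. *)
Lemma sign_mean_expR x :
  sign_mean (fun g => expR (sign_sum x g)) <= expR (2 * \sum_i x i ^+ 2).
Proof.
rewrite /sign_mean /sign_sum; under eq_bigr do rewrite expR_sum.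
rewrite -(bigA_distr_bigA (fun i (b : bool) => expR ((-1) ^+ b * x i))) /=.
rewrite -prodr_const -prodfV -big_split mulr_sumr expR_sum /=.
apply: ler_prod => i _; rewrite big_bool /= expr0 expr1 mul1r mulN1r addrC.
rewrite mulr_ge0 ?invr_ge0 ?addr_ge0 ?expR_ge0//=.
by rewrite mulrC ler_pdivrMr// mulrC cosh_le_expR.
Qed.

Lemma sign_mean_exp_abs (s : R) x :
  sign_mean (fun g => expR `|s * sign_sum x g|) <= 2 * expR (2 * s ^+ 2 * \sum_i x i ^+ 2).
Proof.
have expE (t : R) : sign_mean (fun g => expR (t * sign_sum x g)) <=
    expR (2 * t ^+ 2 * \sum_i x i ^+ 2).
  under eq_sign_mean do rewrite -sign_sumZ.
  apply: le_trans (sign_mean_expR _) _; rewrite ler_expR -mulrA ler_wpM2l//.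
  by rewrite mulr_sumr ler_sum// => i _; rewrite exprMn.
have := expE s; have := expE (- s); rewrite sqrrN => h1 h2.
apply: (@le_trans _ _ (sign_mean (fun g => expR (s * sign_sum x g) +
    expR (- s * sign_sum x g)))).
  apply: sign_mean_le => g; rewrite mulNr.
  have := expR_ge0 (s * sign_sum x g); have := expR_ge0 (- (s * sign_sum x g)).
  by have [h|/ltW h] := leP 0 (s * sign_sum x g); rewrite ?(ger0_norm h) ?(ler0_norm h); lra.
by rewrite sign_meanD; move: h1 h2; lra.
Qed.

Lemma sign_sum_eq0 x g : \sum_i x i ^+ 2 = 0 -> sign_sum x g = 0.
Proof.
move/eqP; rewrite psumr_eq0 => [/allP x0|i _]; last exact: sqr_ge0.
by apply: big1 => i _; have := x0 i (mem_index_enum _); rewrite sqrf_eq0 => /eqP ->; rewrite mulr0.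
Qed.

(** Chernoff's bound. The choice [s^2 = G / (16 q)] minimises the exponent [2 s^2 q - s sqrt(G q)],
    with value [- G / 8]. *)
Lemma sign_sum_tail (G : R) x : 0 <= G ->
  sign_mean (fun g => (G * (\sum_i x i ^+ 2) < sign_sum x g ^+ 2)%R%:R) <= 2 * expR (- (G / 8)).
Proof.
move=> G0; set q := \sum_i x i ^+ 2.
have [q0|q0] := eqVneq q 0.
  under eq_sign_mean do rewrite sign_sum_eq0// q0 mulr0 expr2 mulr0 ltxx.
  by rewrite sign_mean_cst mulr_ge0 ?expR_ge0.
have {}q0 : 0 < q by rewrite lt_neqAle eq_sym q0 sumr_ge0// => i _; exact: sqr_ge0.
pose s := Num.sqrt (G / (16 * q)).
have s2 : s ^+ 2 = G / (16 * q) by rewrite sqr_sqrtr// divr_ge0// mulr_ge0// ltW.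
apply: (@le_trans _ _ (sign_mean (fun g => expR (- (G / 4)) * expR `|s * sign_sum x g|))).
  apply: sign_mean_le => g; case: ltP => /= hg; last by rewrite mulr_ge0 ?expR_ge0.
  rewrite -expRD -[leLHS]expR0 ler_expR addrC subr_ge0.
  rewrite -(@ler_pXn2r _ 2) ?nnegrE ?divr_ge0// real_normK ?num_real//.
  rewrite [leRHS]exprMn s2 mulrAC ler_pdivlMr; last by rewrite mulr_gt0.
  rewrite (_ : (G / 4) ^+ 2 * _ = G * (G * q)); last by field.
  by rewrite ler_wpM2l// ltW.
rewrite sign_meanZ; apply: (@le_trans _ _ (expR (- (G / 4)) * (2 * expR (2 * s ^+ 2 * q)))).
  by rewrite ler_wpM2l ?expR_ge0// sign_mean_exp_abs.
rewrite mulrCA -expRD s2 ler_wpM2l// ler_expR le_eqVlt; apply/orP; left; apply/eqP.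
by field; rewrite gt_eqF.
Qed.

(** At the scale [s^2 = 1 / q], the inequality [(y / 4)^4 <= expR y] reduces the fourth moment to
    the exponential one. The constant is [2^13 = 4^4 * 2 * 16], where [16] bounds [expR 2]. *)
Lemma sign_sum_fourth_moment x :
  sign_mean (fun g => sign_sum x g ^+ 4) <= 2 ^+ 13 * (\sum_i x i ^+ 2) ^+ 2.
Proof.
set q := \sum_i x i ^+ 2.
have [q0|q0] := eqVneq q 0.
  under eq_sign_mean do rewrite sign_sum_eq0// expr0n.
  by rewrite sign_mean_cst mulr_ge0 ?sqr_ge0 ?exprn_ge0.
have {}q0 : 0 < q by rewrite lt_neqAle eq_sym q0 sumr_ge0// => i _; exact: sqr_ge0.
pose s := Num.sqrt q^-1.
have s2 : s ^+ 2 = q^-1 by rewrite sqr_sqrtr// invr_ge0 ltW.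
apply: (@le_trans _ _ (sign_mean (fun g => q ^+ 2 * 256 * expR `|s * sign_sum x g|))).
  apply: sign_mean_le => g; set h := sign_sum x g.
  have hle : (`|s * h| / 4) ^+ 4 <= expR `|s * h|.
    rewrite [X in _ <= expR X](_ : _ = 4%:R * (`|s * h| / 4)); last by field.
    rewrite expRM_natl ler_pXn2r ?nnegrE ?expR_ge0 ?divr_ge0//.
    by apply: le_trans (expR_ge1Dx _); lra.
  apply: (@le_trans _ _ (q ^+ 2 * 256 * (`|s * h| / 4) ^+ 4)); last first.
    by rewrite ler_wpM2l// mulr_ge0 ?sqr_ge0.
  rewrite le_eqVlt; apply/orP; left; apply/eqP.
  rewrite (_ : (`|s * h| / 4) ^+ 4 = (`|s * h| ^+ 2) ^+ 2 / 256); last by field.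
  rewrite real_normK ?num_real// (exprMn 2 s h) s2.
  by field; rewrite gt_eqF.
rewrite sign_meanZ; apply: (@le_trans _ _ (q ^+ 2 * 256 * (2 * expR (2 * s ^+ 2 * q)))).
  apply: ler_wpM2l; first by rewrite mulr_ge0 ?sqr_ge0.
  exact: sign_mean_exp_abs.
rewrite s2 mulfVK ?gt_eqF// (_ : 2 ^+ 13 * q ^+ 2 = q ^+ 2 * 256 * (2 * 16)); last by ring.
apply: ler_wpM2l; first by rewrite mulr_ge0 ?sqr_ge0.
rewrite ler_pM2l//.
rewrite (_ : 2 = 4%:R * 2^-1 :> R); last by field.
rewrite expRM_natl (_ : 16 = 2 ^+ 4 :> R); last by ring.
by rewrite ler_pXn2r ?nnegrE ?expR_ge0// expR_half_le2.
Qed.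

End SignTail.

(** * The multi-dimensional inequality *)

(** Since [168 = 8 * 21], the exponential is [(psi / D)^21]. Two of the powers supply [psi ^+ 2] and
    absorb the factor [D] of the union bound over in-neighbours; the other nineteen give [2^-19],
    because [psi / D <= 1/2]. *)
Lemma bad_probability_small (R : realType) (D psi : R) : 0 < psi -> psi <= 1 -> 2 <= D ->
  D * (2 * expR (- (168 * ln (D / psi) / 8))) <= psi ^+ 2 / 2 ^+ 19.
Proof.
move=> psi0 psi1 D2; have D0 : 0 < D by lra.
pose y := psi / D.
have y0 : 0 < y by rewrite divr_gt0.
have y2 : y <= 2^-1.
  by rewrite /y ler_pdivrMr// -[leLHS]mul1r (le_trans (ler_wpM2r (ltW psi0) (lexx _)))// mul1r; lra.
have -> : expR (- (168 * ln (D / psi) / 8)) = y ^+ 21.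
  rewrite (_ : D / psi = y^-1); last by rewrite /y invf_div.
  rewrite lnV ?posrE// (_ : - _ = 21%:R * ln y); last by field.
  by rewrite expRM_natl lnK.
have y19 : y ^+ 19 <= (2 ^+ 19)^-1.
  rewrite (_ : (2 ^+ 19)^-1 = 2^-1 ^+ 19); last by field.
  by rewrite ler_pXn2r ?nnegrE ?invr_ge0// ltW.
have -> : D * (2 * y ^+ 21) = 2 / D * psi ^+ 2 * y ^+ 19.
  by rewrite (exprD y 2 19) /y; field; rewrite gt_eqF.
have D2le : 0 <= 2 / D <= 1 by rewrite divr_ge0 ?(ltW D0)//= ler_pdivrMr// mul1r.
have /andP[D3 D4] := D2le.
apply: ler_pM y19; [by rewrite mulr_ge0 ?sqr_ge0|by rewrite exprn_ge0 ?(ltW y0)|].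
by rewrite ler_piMl ?sqr_ge0.
Qed.

(** [one_dimensional_bound] is applied to the random signed sum [h g] of the components of [f] and
    averaged over [g]. A vertex is bad when, for some in-neighbour, the squared increment of [h g]
    exceeds [G] times its mean [q u v]. The bad terms cost on average at most [psi / 4] times the
    variance, so [psi / 2] of the [3 / 4 * psi] survives. *)
Lemma multi_dimensional_bound (R : realType) (V I : finType) (E : rel V)
    (pi : V -> R) (psi D : R) (f : I -> V -> R) (a c : V -> R) :
  reflexive E -> is_distribution pi -> 0 < psi -> psi <= 1 ->
  (forall S : {set V}, psi * Num.min (weight pi S) (weight pi (~: S))
     <= weight pi (out_boundary E S)) ->
  2 <= D -> (forall v, #|[set u | E u v]%SET|%:R <= D) ->
  (forall i, \sum_v pi v * f i v = 0) ->
  (forall u v, E u v -> \sum_i (f i u - f i v) ^+ 2 <= c v + a u - a v) ->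
  psi ^+ 2 * (\sum_i \sum_v pi v * f i v ^+ 2) <=
    128 * (168 * ln (D / psi)) * \sum_v pi v * c v.
Proof.
move=> Er pid psi0 psi1 hpsi D2 hD f0 hf; have [pi0 pi1] := pid.
set G := 168 * ln (D / psi).
have G0 : 0 <= G.
  by rewrite mulr_ge0// ln_ge0// ler_pdivlMr// mul1r; lra.
pose q u v := \sum_i (f i u - f i v) ^+ 2.
have q0 u v : 0 <= q u v by apply: sumr_ge0 => i _; exact: sqr_ge0.
pose h g v := sign_sum (fun i => f i v) g.
have hB g u v : h g u - h g v = sign_sum (fun i => f i u - f i v) g.
  by rewrite /h /sign_sum -sumrB; apply: eq_bigr => i _; rewrite mulrBr.
pose bad g v := [exists u, E u v && (G * q u v < (h g u - h g v) ^+ 2)].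
have hac u v : E u v -> a v - a u <= c v.
  by move=> Euv; have := hf _ _ Euv; have := q0 u v; rewrite /q; lra.
have hgood g u v : E u v -> ~~ bad g v -> (h g u - h g v) ^+ 2 <= G * (c v + a u - a v).
  move=> Euv; rewrite negb_exists => /forallP/(_ u); rewrite Euv /= -leNgt.
  by move/le_trans; apply; rewrite ler_wpM2l// hf.
have h0 g : \sum_v pi v * h g v = 0.
  rewrite /h /sign_sum; under eq_bigr do rewrite mulr_sumr.
  rewrite exchange_big big1 //= => i _; under eq_bigr do rewrite mulrCA.
  by rewrite -mulr_sumr f0 mulr0.
have one g := one_dimensional_bound Er pid psi0 hpsi G0 hac (hgood g) (h0 g).
pose n v := \sum_i f i v ^+ 2.
have n0 v : 0 <= n v by apply: sumr_ge0 => i _; exact: sqr_ge0.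
have badP v : sign_mean (fun g => (bad g v)%:R : R) <= psi ^+ 2 / 2 ^+ 19.
  apply: le_trans (bad_probability_small psi0 psi1 D2); rewrite -/G.
  apply: (@le_trans _ _ (sign_mean (fun g => \sum_(u | E u v)
      (G * q u v < sign_sum (fun i => f i u - f i v) g ^+ 2)%R%:R))).
    apply: sign_mean_le => g; rewrite /bad; case: existsP => [[u /andP[Euv hu]]|_].
      by rewrite (bigD1 u)//= -hB hu lerDl sumr_ge0.
    exact: sumr_ge0.
  rewrite sign_mean_sum.
  apply: (@le_trans _ _ (\sum_(u | E u v) 2 * expR (- (G / 8)))).
    by apply: ler_sum => u _; exact: sign_sum_tail.
  rewrite sumr_const -[leLHS]mulr_natl ler_wpM2r ?mulr_ge0 ?expR_ge0//.
  by rewrite (le_trans _ (hD v))// cardsE.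
have badh v : sign_mean (fun g => (bad g v)%:R * h g v ^+ 2) <= psi / 8 * n v.
  have [nv|nv] := eqVneq (n v) 0.
    under eq_sign_mean do rewrite /h sign_sum_eq0// expr0n mulr0.
    by rewrite sign_mean_cst nv mulr0.
  have {}nv : 0 < n v by rewrite lt_neqAle eq_sym nv n0.
  have p17 : 0 <= psi / (2 ^+ 17 * n v).
    by rewrite divr_ge0 ?(ltW psi0)// mulr_ge0 ?exprn_ge0.
  have p15 : 0 <= 2 ^+ 15 * n v / psi.
    by rewrite divr_ge0 ?(ltW psi0)// mulr_ge0 ?exprn_ge0.
  (* Young's inequality, balanced so that the fourth moment, with constant [2^13], and the bad
     probability, at most [psi^2 / 2^19], each contribute [psi / 16 * n v]. *)
  apply: (@le_trans _ _ (sign_mean (fun g => psi / (2 ^+ 17 * n v) * h g v ^+ 4 +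
      2 ^+ 15 * n v / psi * (bad g v)%:R))).
    apply: sign_mean_le => g; case: (bad g v); last first.
      by rewrite mul0r mulr0 addr0 mulr_ge0// exprn_even_ge0.
    rewrite mul1r mulr1 -subr_ge0.
    rewrite (_ : _ - _ = 2 ^+ 15 * n v / psi * (psi / (2 ^+ 16 * n v) * h g v ^+ 2 - 1) ^+ 2).
      by rewrite mulr_ge0 ?sqr_ge0.
    by field; rewrite !gt_eqF.
  rewrite sign_meanD !sign_meanZ.
  have := ler_wpM2l p15 (badP v).
  have := ler_wpM2l p17 (sign_sum_fourth_moment (fun i => f i v)).
  rewrite -/(n v) (_ : psi / _ * (2 ^+ 13 * _) = psi / 16 * n v); last by field; rewrite gt_eqF.
  rewrite (_ : 2 ^+ 15 * n v / psi * (_ / _) = psi / 16 * n v); last by field; rewrite gt_eqF.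
  by rewrite /h; lra.
have := sign_mean_le one.
rewrite sign_meanZ sign_meanD sign_meanZ sign_mean_cst !sign_mean_sum.
under eq_bigr do rewrite sign_meanZ /h sign_mean_sqr.
rewrite -/h; under [in X in _ <= X -> _]eq_bigr do rewrite sign_meanZ.
set C := \sum_v pi v * c v => main.
have QE : \sum_i \sum_v pi v * f i v ^+ 2 = \sum_v pi v * n v.
  by rewrite exchange_big; apply: eq_bigr => v _; rewrite /n mulr_sumr.
have hbad : \sum_v pi v * sign_mean (fun g => (bad g v)%:R * h g v ^+ 2) <=
    psi / 8 * \sum_v pi v * n v.
  by rewrite mulr_sumr; apply: ler_sum => v _; rewrite [leRHS]mulrCA ler_wpM2l.
rewrite QE; set Q := \sum_v pi v * n v in main hbad *.
have : psi * (psi / 2 * Q) <= psi * (64 * G / psi * C).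
  by rewrite ler_wpM2l ?(ltW psi0)//; move: main hbad; rewrite -/Q; lra.
by rewrite (_ : psi * (64 * G / psi * C) = 64 * G * C); [lra|field; rewrite gt_eqF].
Qed.

(** * Minimax and existence of the flow *)

(* A minimiser [x] over [K] of the sum of the squared negative parts
   [w j = Num.max 0 (- L j x)] satisfies [sum w j * L j z <= - sum (w j)^2] for
   every [z] of [K], so a [z] answering these weights forces [w = 0]. *)
Lemma finite_minimax (R : realType) (X : topologicalType) (J : choiceType)
    (K : set X) (L : J -> X -> R) (r : seq J) :
  compact K -> (K !=set0)%classic -> (forall j, continuous (L j)) ->
  (forall x z (t : R), K x -> K z -> 0 <= t <= 1 ->
    exists2 y, K y & forall j, L j y = (1 - t) * L j x + t * L j z) ->
  (forall w : J -> R, (forall j, 0 <= w j) ->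
    exists2 x, K x & 0 <= \sum_(j <- r) w j * L j x) ->
  exists2 x, K x & forall j, j \in r -> 0 <= L j x.
Proof.
move=> cK K0 cL convK hK.
pose Phi x := \sum_(j <- r) Num.max 0 (- L j x) ^+ 2.
have cPhi : continuous Phi.
  apply: (continuous_big (P := xpredT) add_continuous) => j _ x.
  have cm : {for x, continuous (fun x => Num.max 0 (- L j x) : R^o)}.
    by apply: continuous_max; [exact: cvg_cst|apply: continuousN; exact: cL].
  under eq_fun do rewrite expr2.
  exact: (continuousM cm cm).
have [x /set_mem Kx xmin] :=
  compact_EVT_min K0 cK (continuous_subspaceT (fun x => cPhi x)).
exists x => // j0 j0r.
pose w j := Num.max 0 (- L j x).
have w0 j : 0 <= w j by rewrite /w le_max lexx.
have [z Kz hz] := hK w w0.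
pose d j := L j z - L j x.
(* Minimality of [x] against the point a fraction [t] of the way to [z]; small [t] gives the
   first-order condition. *)
have key t : 0 < t -> t <= 1 ->
    2 * (\sum_(j <- r) w j * d j) <= t * \sum_(j <- r) d j ^+ 2.
  move=> t0 t1.
  have [y Ky hy] : exists2 y, K y & forall j, L j y = (1 - t) * L j x + t * L j z.
    by apply: convK => //; rewrite (ltW t0) t1.
  have := xmin y (mem_set Ky).
  have : Phi y <= \sum_(j <- r) (w j - t * d j) ^+ 2.
    apply: ler_sum => j _; rewrite hy.
    have -> : (1 - t) * L j x + t * L j z = L j x + t * d j by rewrite /d; ring.
    rewrite /w; set a := L j x; set b := t * d j.
    have [h1|/ltW h1] := leP 0 (- (a + b)); last by rewrite expr0n sqr_ge0.
    have [h2|/ltW h2] := leP 0 (- a); first by rewrite opprD.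
    have b0 : 0 <= - b by move: h1 h2; lra.
    rewrite add0r; apply: lerXn2r; rewrite ?nnegrE//.
    by rewrite opprD gerDr.
  have -> : \sum_(j <- r) (w j - t * d j) ^+ 2 = Phi x -
      t * (2 * (\sum_(j <- r) w j * d j) - t * \sum_(j <- r) d j ^+ 2).
    rewrite !mulr_sumr -sumrB mulr_sumr -sumrB; apply: eq_bigr => j _.
    by rewrite -/(w j); ring.
  move=> h1 /le_trans /(_ h1); by rewrite lerBrDr gerDl (pmulr_rle0 _ t0) subr_le0.
have {key} key : \sum_(j <- r) w j * d j <= 0.
  rewrite leNgt; apply/negP => s0; set s := \sum_(j <- r) w j * d j in key s0.
  set q := \sum_(j <- r) d j ^+ 2 in key.
  have q0 : 0 <= q by apply: sumr_ge0 => j _; exact: sqr_ge0.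
  (* This [t] lies in the unit interval even if [q = 0], and turns [key] into [2 s (s + q) <= s q],
     false for [s > 0]. *)
  have := key (s / (s + q)) (ltac:(rewrite divr_gt0//; lra)) (ltac:(rewrite ler_pdivrMr; lra)).
  rewrite mulrAC ler_pdivlMr; last by lra.
  by nra.
have wL j : w j * L j x = - w j ^+ 2.
  rewrite /w; case: (leP 0 (- L j x)) => _; first by ring.
  by rewrite mul0r expr0n oppr0.
have : \sum_(j <- r) w j ^+ 2 <= 0.
  have E : \sum_(j <- r) w j * d j = \sum_(j <- r) w j * L j z + \sum_(j <- r) w j ^+ 2.
    by rewrite -big_split; apply: eq_bigr => j _; rewrite /d mulrBr wL opprK.
  by move: key hz; rewrite E; lra.
have sq0 j : 0 <= w j ^+ 2 by exact: sqr_ge0.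
rewrite le_eqVlt ltNge sumr_ge0 ?orbF// psumr_eq0// => /allP/(_ _ j0r).
by rewrite sqrf_eq0 /w => /eqP; case: (leP 0 (- L j0 x)); lra.
Qed.

(** The sets [0 <= L j x] are closed, and [finite_minimax] says that any finitely many of them meet
    in [K], so compactness gives a common point. *)
Lemma compact_minimax (R : realType) (X : ptopologicalType) (J : choiceType)
    (A : set J) (K : set X) (L : J -> X -> R) :
  compact K -> (K !=set0)%classic -> (forall j, continuous (L j)) ->
  (forall x z (t : R), K x -> K z -> 0 <= t <= 1 ->
    exists2 y, K y & forall j, L j y = (1 - t) * L j x + t * L j z) ->
  (forall (r : seq J) (w : J -> R), (forall j, j \in r -> A j) -> (forall j, 0 <= w j) ->
    exists2 x, K x & 0 <= \sum_(j <- r) w j * L j x) ->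
  exists2 x, K x & forall j, A j -> 0 <= L j x.
Proof.
move=> cK K0 cL convK hK.
have [[j0 Aj0]|A0] := pselect (exists j, A j); last first.
  by have [x Kx] := K0; exists x => // j Aj; case: A0; exists j.
move: (cK); rewrite compact_In0 => /(_ J A (fun j => K `&` [set x | 0 <= L j x])%classic).
case=> [||x hx].
- exists (fun j => [set x | 0 <= L j x])%classic => // j _.
  exact: (preimage_closed (fun x _ => cL j x) (@closed_ge _ 0)).
- move=> D DA; have [|x Kx hx] := finite_minimax (r := finmap.enum_fset D) cK K0 cL convK.
    by move=> w w0; apply: hK => // j /DA; rewrite inE.
  by exists x => j /= jD; split => //; apply: hx.
exists x; first by have [] := hx _ Aj0.
by move=> j /hx[].
Qed.

(* The flow is sought among those with prescribed inflow. The potentials [a]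
   are the Lagrange multipliers forcing the outflow to be prescribed as well. *)
Lemma flow_with_spectral_gap (R : realType) (V : finType) (E : rel V)
    (pi : V -> R) (psi D : R) :
  reflexive E -> is_distribution pi -> 0 < psi -> psi <= 1 ->
  (forall S : {set V}, psi * Num.min (weight pi S) (weight pi (~: S))
     <= weight pi (out_boundary E S)) ->
  2 <= D -> (forall v, #|[set u | E u v]%SET|%:R <= D) ->
  exists F : V -> V -> R, [/\ forall u v, 0 <= F u v,
    forall u v, ~~ E u v -> F u v = 0,
    forall v, \sum_u F u v = pi v,
    forall u, \sum_v F u v = pi u &
    forall f : V -> R, \sum_v pi v * f v = 0 ->
      psi ^+ 2 / (128 * (168 * ln (D / psi))) * (\sum_v pi v * f v ^+ 2) <=
      \sum_u \sum_v F u v * (f u - f v) ^+ 2].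
Proof.
move=> Er pid psi0 psi1 hpsi D2 hD; have [pi0 pi1] := pid.
set lam := psi ^+ 2 / _.
have K0 : 0 < 128 * (168 * ln (D / psi)).
  by rewrite !mulr_gt0// ln_gt0// ltr_pdivlMr// mul1r; lra.
pose N := #|{: V * V}|.
pose F (x : 'rV[R]_N) u v : R := x ord0 (enum_rank (u, v)).
(* An index pairs a test function with a potential. On [(f, 0)], nonnegativity of [L] is the gap
   inequality; on [(0, a)] and [(0, - a)] together it says that [a] is orthogonal to the excess of
   inflow over outflow. *)
pose J : choiceType := ((V -> R) * (V -> R))%type.
pose L (j : J) (x : 'rV[R]_N) : R :=
  \sum_u \sum_v F x u v * ((j.1 u - j.1 v) ^+ 2 + j.2 v - j.2 u) -
  lam * \sum_v pi v * j.1 v ^+ 2.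
(* Caps at the prescribed inflow, and at 0 off the edges, put the flows in a compact box. *)
pose cap u v := if E u v then pi v else 0.
pose box := [set x : 'rV[R]_N |
  forall i, `[0, cap (enum_val i).1 (enum_val i).2]%classic (x ord0 i)]%classic.
pose K := (box `&` [set x : 'rV[R]_N | forall v, \sum_u F x u v = pi v])%classic.
have cF u v : continuous (fun x => F x u v) by move=> x; exact: coord_continuous.
have compact_box : compact box.
  apply: (@rV_compact R N (fun i => `[0, cap (enum_val i).1 (enum_val i).2]%classic)).
  by move=> i; exact: segment_compact.
have closed_box : closed box by apply: compact_closed => //; exact: norm_hausdorff.
have compK : compact K.
  apply: (subclosed_compact _ compact_box) => [|x []//].
  apply: closedI => //.
  rewrite (_ : [set x : 'rV[R]_N | _]%classic =
      \bigcap_v ((fun x => \sum_u F x u v) @^-1` [set y | y = pi v]))%classic; last first.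
    by apply/seteqP; split => x /= h v => [_|]; [exact: h|exact: (h v I)].
  apply: closed_bigI => v _; apply: preimage_closed => [x _|]; last exact: closed_eq.
  by apply: (continuous_big (P := xpredT) add_continuous) => u _; exact: cF.
have FP x : K x -> (forall u v, 0 <= F x u v) /\ (forall u v, ~~ E u v -> F x u v = 0).
  move=> [hx _]; split=> u v; have := hx (enum_rank (u, v)); rewrite enum_rankK /= in_itv /=.
    by case/andP.
  by rewrite /cap => + /negbTE Euv; rewrite Euv -eq_le => /eqP /esym.
(* Flows in which [v] receives its whole inflow from [u0 v]. The payoff is linear and the inflow
   constraints decouple over heads, so the best responses have this form. *)
have respond (u0 : V -> V) : (forall v, E (u0 v) v) ->
    exists2 x, K x & forall u v, F x u v = pi v * (u == u0 v)%:R.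
  move=> hu0; pose x := \row_i (let p := enum_val i in pi p.2 * (p.1 == u0 p.2)%:R) : 'rV[R]_N.
  have xE u v : F x u v = pi v * (u == u0 v)%:R by rewrite /F mxE enum_rankK.
  exists x => //; split => [i|v] /=.
    rewrite mxE in_itv /= /cap; case: eqP => [->|_]; last first.
      by rewrite mulr0 lexx; case: ifP; rewrite ?pi0 ?lexx.
    by rewrite hu0 mulr1 pi0 lexx.
  under eq_bigr do rewrite xE.
  rewrite -mulr_sumr (bigD1 (u0 v))//= eqxx big1 ?addr0 ?mulr1// => u /negbTE ->.
  by [].
have cL j : continuous (L j).
  have cQ : continuous (fun x => \sum_u \sum_v F x u v *
      ((j.1 u - j.1 v) ^+ 2 + j.2 v - j.2 u)).
    apply: (continuous_big (P := xpredT) add_continuous) => u _.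
    apply: (continuous_big (P := xpredT) add_continuous) => v _ x.
    exact: (cvgM (cF u v x) (cvg_cst _)).
  by move=> x; exact: (cvgB (cQ x) (cvg_cst _)).
have K_neq0 : (K !=set0)%classic by have [x Kx _] := respond id Er; exists x.
have convK x z (t : R) : K x -> K z -> 0 <= t <= 1 ->
    exists2 y, K y & forall j, L j y = (1 - t) * L j x + t * L j z.
  move=> [x1 x2] [z1 z2] /andP[t0 t1].
  pose y := (1 - t) *: x + t *: z.
  have yE u v : F y u v = (1 - t) * F x u v + t * F z u v by rewrite /F !mxE.
  exists y; first split=> [i|v] /=.
  - have := x1 i; have := z1 i; rewrite /= !in_itv /= !mxE => /andP[? ?] /andP[? ?].
    by rewrite addr_ge0 ?mulr_ge0 ?subr_ge0//=; nra.
  - under eq_bigr do rewrite yE.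
    by rewrite big_split -!mulr_sumr /= x2 z2; ring.
  move=> j; rewrite /L !mulrBr !mulr_sumr addrACA -opprD; congr (_ - _).
    rewrite -big_split; apply: eq_bigr => u _ /=.
    rewrite !mulr_sumr -big_split; apply: eq_bigr => v _ /=.
    by rewrite yE; ring.
  by rewrite -big_split; apply: eq_bigr => v _ /=; ring.
have [r w rA w0|x Kx hx] := compact_minimax
    (A := [set j : J | \sum_v pi v * j.1 v = 0]%classic) compK K_neq0 cL convK.
  pose d u v := \sum_(j <- r) w j * (j.1 u - j.1 v) ^+ 2.
  pose a v := \sum_(j <- r) w j * j.2 v.
  (* The best payoff at [v] becomes the charge [c v] of [multi_dimensional_bound], whose edge
     hypothesis is exactly this maximality. *)
  pose u0 v := [arg max_(u > v | E u v) (d u v + a v - a u)]%O.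
  have [Eu0 u0max] : (forall v, E (u0 v) v) /\
      (forall u v, E u v -> d u v + a v - a u <= d (u0 v) v + a v - a (u0 v)).
    by split=> [v|u v]; rewrite /u0; case: arg_maxP => // x _ h Euv; exact: h.
  have [x Kx xE] := respond u0 Eu0; exists x => //.
  have -> : \sum_(j <- r) w j * L j x =
      \sum_v pi v * (d (u0 v) v + a v - a (u0 v)) -
      lam * \sum_(j <- r) \sum_v pi v * (w j * j.1 v ^+ 2).
    rewrite /L; under eq_bigr do rewrite mulrBr.
    rewrite sumrB; congr (_ - _); last first.
      rewrite mulr_sumr; apply: eq_bigr => j _; rewrite mulrCA; congr (_ * _).
      by rewrite mulr_sumr; apply: eq_bigr => v _; rewrite mulrCA.
    transitivity (\sum_v \sum_u F x u v * (d u v + a v - a u)).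
      under eq_bigr do rewrite mulr_sumr.
      rewrite exchange_big [RHS]exchange_big; apply: eq_bigr => u _ /=.
      under eq_bigr do rewrite mulr_sumr.
      rewrite exchange_big; apply: eq_bigr => v _ /=.
      rewrite /d /a -big_split -sumrB mulr_sumr; apply: eq_bigr => j _ /=; ring.
    apply: eq_bigr => v _; rewrite (bigD1 (u0 v))//= big1 ?addr0.
      by rewrite xE eqxx mulr1.
    by move=> u /negbTE uv; rewrite xE uv mulr0 mul0r.
  (* Square roots of the weights merge the finitely many test functions into one vector-valued map
     with squared increments [d]. *)
  pose g (i : 'I_(size r)) v := Num.sqrt (w (tnth (in_tuple r) i)) * (tnth (in_tuple r) i).1 v.
  have g0 i : \sum_v pi v * g i v = 0.
    under eq_bigr do rewrite mulrCA.
    by rewrite -mulr_sumr (rA (tnth (in_tuple r) i)) ?mulr0// mem_tnth.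
  have gd u v : \sum_i (g i u - g i v) ^+ 2 = d u v.
    rewrite /d [RHS]big_tnth; apply: eq_bigr => i _.
    by rewrite /g -mulrBr exprMn sqr_sqrtr.
  have := multi_dimensional_bound (f := g) (a := a)
    (c := fun v => d (u0 v) v + a v - a (u0 v)) Er pid psi0 psi1 hpsi D2 hD g0.
  have -> : \sum_i \sum_v pi v * g i v ^+ 2 =
      \sum_(j <- r) \sum_v pi v * (w j * j.1 v ^+ 2).
    rewrite [RHS]big_tnth; apply: eq_bigr => i _; apply: eq_bigr => v _.
    by rewrite /g exprMn sqr_sqrtr.
  set Q := \sum_(j <- r) _; set C := \sum_v _ => main.
  rewrite subr_ge0 /lam mulrAC ler_pdivrMr// mulrC [leRHS]mulrC mulrC.
  by apply: main => u v Euv; rewrite gd; have := u0max _ _ Euv; lra.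
have [Fge0 FE] := FP _ Kx; exists (F x); split => //; first by case: Kx.
- move=> u; apply/eqP; rewrite eq_le.
  (* The index with zero test function and potential [s] at [u] only; the two signs of [s] force
     equality. *)
  have lin (s : R) : 0 <= s * (pi u - \sum_v F x u v).
    have A0 : \sum_v pi v * (0 : R) = 0 by apply: big1 => v _; rewrite mulr0.
    have := hx (fun=> 0, fun v => s * (v == u)%:R) A0.
    rewrite /L /= expr0n /= A0 mulr0 subr0.
    under eq_bigr do under eq_bigr do rewrite subrr expr0n add0r mulrBr.
    under eq_bigr do rewrite sumrB.
    rewrite sumrB exchange_big /= (bigD1 u)//= [X in _ + X - _]big1 ?addr0; last first.
      by move=> v /negbTE vu; apply: big1 => w _; rewrite vu !mulr0.
    rewrite [X in _ - X](bigD1 u)//= [X in _ - (_ + X)]big1 ?addr0; last first.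
      by move=> v /negbTE vu; apply: big1 => w _; rewrite vu !mulr0.
    rewrite eqxx mulr1 -!mulr_suml -mulrBl mulrC.
    by case: Kx => _ ->.
  by have := lin 1; have := lin (-1); rewrite mul1r mulN1r; lra.
- move=> f f0; have := hx (f, fun=> 0) f0; rewrite /L /= subr_ge0.
  move/le_trans; apply; apply: ler_sum => u _; apply: ler_sum => v _.
  by rewrite subr0 addr0.
Qed.

(** * Mixing of the lazy chain *)

Lemma sqr_sum_weighted_le (R : realType) (V : finType) (w z : V -> R) :
  (forall v, 0 <= w v) ->
  (\sum_v w v * z v) ^+ 2 <= (\sum_v w v) * \sum_v w v * z v ^+ 2.
Proof.
move=> w0; set W := \sum_v w v; set S := \sum_v w v * z v; set Q := \sum_v _ * _ ^+ 2.
have W0 : 0 <= W by exact: sumr_ge0.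
have [WE|W_neq0] := eqVneq W 0.
  suff -> : S = 0 by rewrite WE expr0n mul0r.
  move/eqP: WE; rewrite psumr_eq0// => /allP wE; apply: big1 => v _.
  by have /eqP -> := wE v (mem_index_enum _); rewrite mul0r.
have : 0 <= \sum_v w v * (W * z v - S) ^+ 2.
  by apply: sumr_ge0 => v _; rewrite mulr_ge0 ?sqr_ge0.
have -> : \sum_v w v * (W * z v - S) ^+ 2 = W * (W * Q - S ^+ 2).
  transitivity (\sum_v (W ^+ 2 * (w v * z v ^+ 2) - 2 * W * S * (w v * z v) + S ^+ 2 * w v)).
    by apply: eq_bigr => v _; ring.
  by rewrite big_split sumrB /= -!mulr_sumr -/Q -/S -/W; ring.
by rewrite pmulr_rge0 ?subr_ge0// lt_neqAle eq_sym W_neq0.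
Qed.

(** The walk of flow [F] averaged with the identity, so that [chi_square_step] meets the midpoints
    of [f u] and [f v]. *)
Definition lazy_chain (R : realType) (V : finType) (pi : V -> R) (F : V -> V -> R)
  (u v : V) : R := ((u == v)%:R + F u v / pi u) / 2.

Definition chi_square (R : realType) (V : finType) (pi p : V -> R) : R :=
  \sum_v (p v - pi v) ^+ 2 / pi v.

Lemma sum_step (R : realType) (V : finType) (P : V -> V -> R) (p : V -> R) :
  (forall u, \sum_v P u v = 1) -> \sum_v step P p v = \sum_v p v.
Proof.
move=> P1; rewrite /step exchange_big; apply: eq_bigr => u _ /=.
by rewrite -mulr_sumr P1 mulr1.
Qed.

Lemma l1_le_chi_square (R : realType) (V : finType) (pi p : V -> R) :
  is_distribution pi -> (forall v, 0 < pi v) ->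
  (\sum_v `|p v - pi v|) ^+ 2 <= chi_square pi p.
Proof.
move=> [pi0 pi1] pip.
have := sqr_sum_weighted_le (fun v => `|p v - pi v| / pi v) pi0.
rewrite pi1 mul1r; under eq_bigr do rewrite mulrC mulfVK ?gt_eqF//.
move=> /le_trans; apply; apply: ler_sum => v _.
rewrite expr_div_n real_normK ?num_real// le_eqVlt; apply/orP; left; apply/eqP.
by field; rewrite gt_eqF.
Qed.

Section LazyChain.
Variables (R : realType) (V : finType) (E : rel V) (pi : V -> R) (F : V -> V -> R).
Hypotheses (Er : reflexive E) (pid : is_distribution pi) (pip : forall v, 0 < pi v).
Hypotheses (F0 : forall u v, 0 <= F u v) (FE : forall u v, ~~ E u v -> F u v = 0).
Hypotheses (Fin : forall v, \sum_u F u v = pi v) (Fout : forall u, \sum_v F u v = pi u).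

Let P := lazy_chain pi F.

Lemma lazy_chain_admissible : admissible_transition E pi P.
Proof.
have pi0 := fun v => ltW (pip v).
have delta (v : V) (g : V -> R) : \sum_u g u * (u == v)%:R = g v.
  rewrite (bigD1 v)//= eqxx mulr1 big1 ?addr0// => u /negbTE ->; exact: mulr0.
split=> [u v|u v|u|v]; rewrite /P /lazy_chain.
- by rewrite divr_ge0// addr_ge0// divr_ge0.
- move=> Euv; rewrite FE// mul0r addr0; case: eqP Euv => [->|_ _]; last exact: mul0r.
  by rewrite Er.
- rewrite -mulr_suml big_split -mulr_suml Fout divff ?gt_eqF//=.
  rewrite (bigD1 u)//= eqxx big1 ?addr0; first by rewrite /=; field.
  by move=> v; rewrite eq_sym => /negbTE ->.
- transitivity (\sum_u (pi u * (u == v)%:R + F u v) / 2).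
    by apply: eq_bigr => u _; field; rewrite gt_eqF.
  by rewrite -mulr_suml big_split /= delta Fin; field.
Qed.

(** With [f = p / pi - 1], the new relative density at [v] is the average of [(f u + f v) / 2] under
    the weights [F u v / pi v]. Cauchy-Schwarz bounds its square, and the parallelogram law turns
    the squared midpoints into the old chi-square distance minus a quarter of the Dirichlet form. *)
Lemma chi_square_step (lam : R) (p : V -> R) :
  (forall f : V -> R, \sum_v pi v * f v = 0 ->
     lam * (\sum_v pi v * f v ^+ 2) <= \sum_u \sum_v F u v * (f u - f v) ^+ 2) ->
  \sum_v p v = 1 ->
  chi_square pi (step P p) <= (1 - lam / 4) * chi_square pi p.
Proof.
move=> gap p1; have [pi0 pi1] := pid.
pose f v := p v / pi v - 1.
have pE v : p v = pi v * (1 + f v) by rewrite /f; field; rewrite gt_eqF.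
have chiE : chi_square pi p = \sum_v pi v * f v ^+ 2.
  by apply: eq_bigr => v _; rewrite /f; field; rewrite gt_eqF.
have f0 : \sum_v pi v * f v = 0.
  transitivity (\sum_v p v - \sum_v pi v); last by rewrite p1 pi1 subrr.
  by rewrite -sumrB; apply: eq_bigr => v _; rewrite pE; ring.
have stepE v : step P p v - pi v = \sum_u F u v * ((f u + f v) / 2).
  rewrite /step /P /lazy_chain.
  transitivity (\sum_u (p u * (u == v)%:R / 2 + F u v * (1 + f u) / 2) - pi v).
    congr (_ - _); apply: eq_bigr => u _; rewrite [in F u v * (1 + f u) / 2]/f.
    by field; rewrite gt_eqF.
  rewrite big_split /= (bigD1 v)//= eqxx big1 ?addr0; last first.
    by move=> u /negbTE ->; rewrite mulr0 mul0r.
  rewrite pE -(Fin v) mulr1 !mulr_suml -big_split -sumrB /=.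
  by apply: eq_bigr => u _; field.
apply: (@le_trans _ _ (\sum_v \sum_u F u v * ((f u + f v) / 2) ^+ 2)).
  apply: ler_sum => v _; rewrite stepE ler_pdivrMr// mulrC -(Fin v).
  exact: sqr_sum_weighted_le.
have -> : \sum_v \sum_u F u v * ((f u + f v) / 2) ^+ 2 =
    \sum_v pi v * f v ^+ 2 - (\sum_u \sum_v F u v * (f u - f v) ^+ 2) / 4.
  have eqA : \sum_v pi v * f v ^+ 2 = \sum_v \sum_u F u v * f v ^+ 2.
    by apply: eq_bigr => v _; rewrite -mulr_suml Fin.
  have eqB : \sum_v pi v * f v ^+ 2 = \sum_v \sum_u F u v * f u ^+ 2.
    by rewrite exchange_big; apply: eq_bigr => u _; rewrite -mulr_suml Fout.
  rewrite [X in _ - X / 4]exchange_big mulr_suml /=.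
  rewrite (_ : \sum_v pi v * f v ^+ 2 = (\sum_v pi v * f v ^+ 2) / 2 +
    (\sum_v pi v * f v ^+ 2) / 2); last by field.
  rewrite {1}eqA eqB !mulr_suml -big_split -sumrB /=; apply: eq_bigr => v _.
  rewrite !mulr_suml -big_split -sumrB /=; apply: eq_bigr => u _.
  by field.
by rewrite chiE; have := gap f f0; lra.
Qed.

(** The chi-square distance starts below [M], because [p0^2 / pi <= M p0]. After [t] steps it is at
    most [expR (-4)], so the l1 distance is at most [expR (-2)], strictly below the threshold. *)
Lemma lazy_mixing_time (lam M : R) (t : nat) :
  (forall f : V -> R, \sum_v pi v * f v = 0 ->
     lam * (\sum_v pi v * f v ^+ 2) <= \sum_u \sum_v F u v * (f u - f v) ^+ 2) ->
  0 < lam <= 4 -> (forall v, (pi v)^-1 <= M) -> 4 / lam * (4 + ln M) <= t%:R ->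
  (mixing_time P pi <= t%:R%:E)%E.
Proof.
move=> gap /andP[lam0 lam4] piM ht.
have [_ _ P1 _] := lazy_chain_admissible.
have [pi0 pi1] := pid.
have [v0 _] := distribution_inhabited pid.
have M0 : 0 < M by rewrite (lt_le_trans _ (piM v0))// invr_gt0.
apply: ereal_inf_lbound; exists t => //=.
apply: (@le_lt_trans _ _ (expR (-2))%:E); last first.
  by rewrite lte_fin -expRN ltr_expR; lra.
apply: ub_ereal_sup => _ [p0 [p00 p01] <-]; rewrite lee_fin.
have dist s : \sum_v distribution_at P p0 s v = 1 /\
    chi_square pi (distribution_at P p0 s) <= (1 - lam / 4) ^+ s * M.
  elim: s => [|s [s1 sle]]; split => //=.
  - rewrite expr0 mul1r.
    apply: (@le_trans _ _ (\sum_v (p0 v * M - 2 * p0 v + pi v))).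
      apply: ler_sum => v _.
      have p0v : p0 v <= 1.
        by rewrite -p01 (bigD1 v)//= lerDl sumr_ge0.
      have -> : (p0 v - pi v) ^+ 2 / pi v = p0 v * (p0 v / pi v) - 2 * p0 v + pi v.
        by field; rewrite gt_eqF.
      rewrite lerD2r lerD2r ler_wpM2l// (le_trans _ (piM v))//.
      by rewrite ler_piMl// invr_ge0.
    by rewrite big_split sumrB /= -mulr_suml -mulr_sumr p01 pi1; lra.
  - by rewrite sum_step.
  - apply: le_trans (chi_square_step gap s1) _.
    by rewrite exprS -mulrA ler_wpM2l//; lra.
rewrite -(@ler_pXn2r _ 2) ?nnegrE ?expR_ge0 ?sumr_ge0//.
apply: le_trans (l1_le_chi_square _ pid pip) _.
apply: le_trans (dist t).2 _.
apply: (@le_trans _ _ (expR (- (lam / 4)) ^+ t * M)).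
  rewrite ler_wpM2r ?(ltW M0)//; apply: lerXn2r; rewrite ?nnegrE ?expR_ge0//; first by lra.
  by apply: le_trans (expR_ge1Dx _); lra.
rewrite -expRM_natl -expRM_natl -{1}(lnK (M0 : M \is Num.pos)) -expRD ler_expR.
have : lam / 4 * (4 / lam * (4 + ln M)) <= lam / 4 * t%:R.
  by rewrite ler_wpM2l// divr_ge0// ltW.
rewrite mulrA (_ : lam / 4 * (4 / lam) = 1); last by field; rewrite gt_eqF.
lra.
Qed.

End LazyChain.

(** * Lower bound on mixing times *)

Section Escape.
Variables (R : realType) (V : finType) (E : rel V) (pi : V -> R) (P : V -> V -> R).
Hypotheses (pid : is_distribution pi) (PE : admissible_transition E pi P).

Let flow (A B : {set V}) := \sum_(u in A) \sum_(v in B) pi u * P u v.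

(** Row sums and stationarity identify both sides with the weight of [S] minus [flow S S]. *)
Lemma flow_balanced (S : {set V}) : flow S (~: S) = flow (~: S) S.
Proof.
have [P0 _ P1 Pst] := PE.
have outS : weight pi S = flow S S + flow S (~: S).
  rewrite /weight /flow -big_split; apply: eq_bigr => u _ /=.
  rewrite -[LHS]mulr1 -(P1 u) mulr_sumr (bigID (mem S)) /=; congr (_ + _).
  by apply: eq_bigl => v; rewrite inE.
have inS : weight pi S = flow S S + flow (~: S) S.
  rewrite /flow exchange_big [X in _ + X]exchange_big -big_split.
  apply: eq_bigr => v _ /=; rewrite -[LHS]Pst (bigID (mem S)) /=; congr (_ + _).
  by apply: eq_bigl => u; rewrite inE.
by apply: (addrI (flow S S)); rewrite -outS.
Qed.

(** What enters a boundary vertex [v] from [S] is part of its total inflow, which stationarity fixes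
    at [pi v]. *)
Lemma flow_le_boundary (S : {set V}) : flow S (~: S) <= weight pi (out_boundary E S).
Proof.
have [P0 PnE P1 Pst] := PE; have [pi0 _] := pid.
rewrite /flow exchange_big /weight /= [leRHS]big_mkcond [leLHS]big_mkcond.
apply: ler_sum => v _; rewrite !inE; case: ifP => // vS.
case: ifP => [_|/negbT].
  rewrite -[leRHS]Pst [leRHS](bigID (mem S)) lerDl sumr_ge0// => u _.
  by rewrite mulr_ge0.
rewrite negb_exists => /forallP h; rewrite big1// => u uS.
by have := h u; rewrite uS /= => /PnE ->; rewrite mulr0.
Qed.

(* Started from [pi] conditioned on [S], the chain stays below [pi / pi S], so
   at each step at most [flow S (~: S) / pi S] of its mass leaves [S]. *)
Lemma escape_time (S : {set V}) (t : nat) :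
  0 < weight pi S -> weight pi S <= weight pi (~: S) ->
  (worst_distance P pi t < (expR 1)^-1%:E)%E ->
  16^-1 <= t%:R * set_vertex_expansion E pi S.
Proof.
move=> S0 SC mixed; have [P0 PnE P1 Pst] := PE; have [pi0 pi1] := pid.
pose p0 v := pi v * (v \in S)%:R / weight pi S.
have p0d : is_distribution p0.
  split=> [v|]; first by rewrite divr_ge0 ?(ltW S0)// mulr_ge0.
  by rewrite -mulr_suml -sum_indicator divff ?gt_eqF.
pose p := distribution_at P p0.
have p_ge0 s v : 0 <= p s v.
  elim: s v => [|s ih] v; first by have [] := p0d.
  by apply: sumr_ge0 => u _; rewrite mulr_ge0// ih.
have p_le s v : p s v <= pi v / weight pi S.
  elim: s v => [|s ih] v /=.
    rewrite /p /p0 /= ler_wpM2r ?invr_ge0 ?(ltW S0)//.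
    by case: (v \in S); rewrite ?mulr1 ?mulr0.
  rewrite -(Pst v) mulr_suml; apply: ler_sum => u _.
  by rewrite mulrAC ler_wpM2r// ih.
have mass s : \sum_(v in ~: S) p s v <= s%:R * (flow S (~: S) / weight pi S).
  elim: s => [|s ih].
    rewrite mul0r big1// => v; rewrite inE => /negbTE vS.
    by rewrite /p /p0 /= vS mulr0 mul0r.
  rewrite -natr1 mulrDl mul1r /p /= -/(p s) /step exchange_big /=.
  rewrite (bigID (mem S)) /= addrC; apply: lerD.
    apply: le_trans ih; rewrite [leRHS](eq_bigl (fun v => v \notin S)); last first.
      by move=> v; rewrite inE.
    apply: ler_sum => u _; rewrite -mulr_sumr ler_piMr// -(P1 u).
    by rewrite [leRHS](bigID (mem (~: S))) lerDl sumr_ge0.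
  rewrite /flow mulr_suml; apply: ler_sum => u _.
  rewrite mulr_suml; apply: ler_sum => v _.
  by rewrite mulrAC ler_wpM2r// p_le.
have dist : \sum_v `|p t v - pi v| < (expR 1)^-1.
  rewrite -lte_fin; apply: le_lt_trans mixed; apply: ereal_sup_ubound.
  by exists p0.
have far : weight pi (~: S) - \sum_(v in ~: S) p t v <= \sum_v `|p t v - pi v|.
  rewrite /weight -sumrB [leLHS]big_mkcond; apply: ler_sum => v _.
  by case: ifP => // _; rewrite distrC ler_norm.
have half : 2^-1 <= weight pi (~: S).
  suff : weight pi S + weight pi (~: S) = 1 by lra.
  rewrite -pi1 [RHS](bigID (mem S)) /=; congr (_ + _).
  by apply: eq_bigl => v; rewrite inE.
(* The complement of [S] has stationary weight at least [1/2], so a distance below [7/16] requires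
   mass [1/16] to have left [S]. *)
have e_le : (expR 1)^-1 <= 7 / 16 :> R.
  by rewrite -[leRHS]invf_div lef_pV2 ?posrE ?expR_gt0 ?divr_gt0// expR1_ge.
(* By balance the escaping flow is bounded by either of the two boundaries, hence by their
   minimum. *)
have flow_le : flow S (~: S) / weight pi S <= set_vertex_expansion E pi S.
  rewrite /set_vertex_expansion (min_l SC) ler_wpM2r ?invr_ge0 ?(ltW S0)//.
  rewrite le_min flow_le_boundary /= flow_balanced.
  by have := flow_le_boundary (~: S); rewrite finset.setCK.
have := ler_wpM2l (ler0n R t) flow_le; have := mass t.
by move: dist far half e_le; lra.
Qed.

Lemma set_vertex_expansionC (S : {set V}) :
  set_vertex_expansion E pi (~: S) = set_vertex_expansion E pi S.
Proof. by rewrite /set_vertex_expansion finset.setCK minC [Num.min (weight pi S) _]minC. Qed.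

Lemma mixing_expansion (S : {set V}) (t : nat) : (forall v, 0 < pi v) ->
  S != finset.set0 -> S \proper finset.setT ->
  (worst_distance P pi t < (expR 1)^-1%:E)%E ->
  16^-1 <= t%:R * set_vertex_expansion E pi S.
Proof.
move=> pip Sn0 SnT mixed.
have CSn0 : ~: S != finset.set0.
  by apply: contraTneq SnT => CS0; rewrite -(finset.setCK S) CS0 finset.setC0 fintype.properxx.
have [SC|/ltW CS] := leP (weight pi S) (weight pi (~: S)).
  exact: escape_time (weight_gt0 pip Sn0) SC mixed.
rewrite -set_vertex_expansionC; apply: escape_time (weight_gt0 pip CSn0) _ mixed.
by rewrite finset.setCK.
Qed.

End Escape.

(** * Proof of the theorem *)

Lemma ln_ge_half (R : realType) (x : R) : 2 <= x -> 2^-1 <= ln x.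
Proof.
move=> x2; rewrite -(expRK 2^-1) ler_ln ?posrE ?expR_gt0//; last by lra.
exact: le_trans (expR_half_le2 R) x2.
Qed.

Section MixingBounds.
Variables (R : realType) (V : finType) (E : rel V) (pi : V -> R).
Hypotheses (Er : reflexive E) (pid : is_distribution pi).

Lemma min_weight_attained :
  exists2 v0, min_weight pi = (pi v0)%:E & forall v, pi v0 <= pi v.
Proof.
have [x _] := distribution_inhabited pid.
pose v0 := [arg min_(v < x) pi v]%O.
have v0min v : pi v0 <= pi v by rewrite /v0; case: arg_minP => // i _; apply.
exists v0 => //; apply/le_anti/andP; split; first exact: bigmin_le.
by apply/bigmin_geP; split=> [|v _]; rewrite ?leey// lee_fin.
Qed.

Lemma set_vertex_expansion_bounds (S : {set V}) : 0 <= set_vertex_expansion E pi S <= 1.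
Proof.
have [pi0 pi1] := pid.
have w0 (A : {set V}) : 0 <= weight pi A by exact: weight_ge0.
have wS (A B : {set V}) : A \subset B -> weight pi A <= weight pi B.
  move=> /fintype.subsetP AB; rewrite /weight [leLHS]big_mkcond [leRHS]big_mkcond.
  apply: ler_sum => v _; case: ifP => [/AB ->//|_]; by case: ifP.
rewrite /set_vertex_expansion divr_ge0 ?le_min ?w0//=.
set den := Num.min (weight pi S) _.
have num_le : Num.min (weight pi (out_boundary E S))
    (weight pi (out_boundary E (~: S))) <= den.
  have inC (A : {set V}) : out_boundary E A \subset ~: A.
    by apply/fintype.subsetP => v; rewrite !inE => /andP[].
  have := inC (~: S); rewrite finset.setCK => inS.
  by rewrite minC le_min !ge_min (wS _ _ inS) (wS _ _ (inC S)) orbT.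
have [den0|den0] := eqVneq den 0; first by rewrite den0 invr0 mulr0.
by rewrite ler_pdivrMr ?mul1r// lt_neqAle eq_sym den0 le_min !w0.
Qed.

Lemma vertex_expansion_attained (S1 : {set V}) :
  S1 != finset.set0 -> S1 \proper finset.setT ->
  exists S0 : {set V}, [/\ S0 != finset.set0, S0 \proper finset.setT,
    vertex_expansion E pi = (set_vertex_expansion E pi S0)%:E &
    forall S : {set V}, S != finset.set0 -> S \proper finset.setT ->
      set_vertex_expansion E pi S0 <= set_vertex_expansion E pi S].
Proof.
move=> S1n0 S1T.
pose Q (S : {set V}) := (S != finset.set0) && (S \proper finset.setT).
have QS1 : Q S1 by rewrite /Q S1n0.
pose S0 := [arg min_(S < S1 | Q S) set_vertex_expansion E pi S]%O.
have [/andP[S0n0 S0T] S0min] : Q S0 /\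
    forall S, Q S -> set_vertex_expansion E pi S0 <= set_vertex_expansion E pi S.
  by rewrite /S0; case: arg_minP.
exists S0; split => // [|S Sn0 ST]; last by apply: S0min; rewrite /Q Sn0.
apply/le_anti/andP; split; first by apply: bigmin_le_cond; rewrite S0n0.
by apply/bigmin_geP; split=> [|S QS]; rewrite ?leey// lee_fin S0min.
Qed.

Lemma vertex_expansion_trivial :
  (forall S : {set V}, S != finset.set0 -> ~~ (S \proper finset.setT)) ->
  vertex_expansion E pi = +oo%E.
Proof.
move=> h; rewrite /vertex_expansion big1// => S /andP[Sn0].
by rewrite (negbTE (h _ Sn0)).
Qed.

Lemma vertex_expansionP (psi : R) : (forall v, 0 < pi v) ->
  (forall S : {set V}, S != finset.set0 -> S \proper finset.setT ->
      psi <= set_vertex_expansion E pi S) ->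
  forall S : {set V}, psi * Num.min (weight pi S) (weight pi (~: S))
     <= weight pi (out_boundary E S).
Proof.
move=> pip hpsi S.
have w0 (A : {set V}) : 0 <= weight pi A by apply: weight_ge0 => v; exact: ltW.
have [->|Sn0] := eqVneq S finset.set0.
  rewrite min_l; first by rewrite {1}/weight big_set0 mulr0.
  by rewrite {1}/weight big_set0.
have [CS0|CSn0] := eqVneq (~: S) finset.set0.
  rewrite CS0 min_r; first by rewrite {1}/weight big_set0 mulr0.
  by rewrite {1}/weight big_set0.
have ST : S \proper finset.setT.
  by rewrite finset.properT; apply: contraNneq CSn0 => ->; rewrite finset.setCT.
have := hpsi S Sn0 ST; rewrite /set_vertex_expansion ler_pdivlMr; last first.
  by rewrite lt_min !weight_gt0.
by move/le_trans; apply; rewrite ge_min lexx.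
Qed.

Lemma max_total_degree_ge2 : V -> (2 <= max_total_degree E)%N.
Proof.
move=> v; apply: leq_trans (leq_bigmax v); rewrite /total_degree.
have h1 : (0 < #|[set u | E u v]%SET|)%N by apply/card_gt0P; exists v; rewrite inE Er.
have h2 : (0 < #|[set u | E v u]%SET|)%N by apply/card_gt0P; exists v; rewrite inE Er.
by move: h1 h2; lia.
Qed.

Lemma indegree_le_max (v : V) : (#|[set u | E u v]%SET| <= max_total_degree E)%N.
Proof. by apply: leq_trans (leq_bigmax v); rewrite /total_degree leq_addr. Qed.

Lemma fastest_mixing_time_ge (x : \bar R) :
  (forall P t, admissible_transition E pi P ->
    (worst_distance P pi t < (expR 1)^-1%:E)%E -> (x <= t%:R%:E)%E) ->
  (x <= fastest_mixing_time E pi)%E.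
Proof.
move=> h; apply/ereal_infP => _ [P /= PE <-].
by apply/ereal_infP => _ [t /= mixed <-]; exact: h mixed.
Qed.

Lemma fastest_mixing_time_le P t : admissible_transition E pi P ->
  (mixing_time P pi <= t%:R%:E)%E -> (fastest_mixing_time E pi <= t%:R%:E)%E.
Proof. by move=> PE; apply: le_trans; apply: ereal_inf_lbound; exists P. Qed.

(** Without a proper nonempty subset [V] is a single vertex, where every distribution is stationary
    at time 0. *)
Lemma fastest_mixing_time_trivial :
  (forall S : {set V}, S != finset.set0 -> ~~ (S \proper finset.setT)) ->
  (fastest_mixing_time E pi <= 0)%E.
Proof.
move=> h; have [v0 _ _] := min_weight_attained.
have allE v : v = v0.
  have := h [set v0]%SET; rewrite finset.properT negbK => /(_ _)/eqP hT.
  apply/set1P; rewrite hT ?inE//; apply/finset.set0Pn; exists v0; exact/set11.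
have sumE (f : V -> R) : \sum_v f v = f v0.
  by rewrite (bigD1 v0)//= big1 ?addr0// => v; rewrite (allE v) eqxx.
have distE (p : V -> R) v : is_distribution p -> p v = 1.
  by move=> [_]; rewrite sumE (allE v).
apply: (@fastest_mixing_time_le (fun=> fun=> 1) 0).
  split; first by [].
  - by move=> u v; rewrite (allE u) (allE v) Er.
  - by move=> u; rewrite sumE.
  - by move=> v; rewrite sumE mulr1 (allE v).
apply: ereal_inf_lbound; exists 0%N => //=.
apply: (@le_lt_trans _ _ 0%E); last by rewrite lte_fin invr_gt0 expR_gt0.
apply: ub_ereal_sup => _ [p0 p0d <-]; rewrite lee_fin sumE /=.
by rewrite !distE// subrr normr0.
Qed.

Lemma fastest_mixing_time_upper (psi m : R) : V ->
  0 < psi <= 1 -> 0 < m -> (forall v, m <= pi v) -> m <= 2^-1 ->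
  (forall S : {set V}, psi * Num.min (weight pi S) (weight pi (~: S))
     <= weight pi (out_boundary E S)) ->
  (fastest_mixing_time E pi <=
    (38 * (128 * 168) * (psi ^- 2 * ln ((max_total_degree E)%:R / psi) * ln m^-1))%:E)%E.
Proof.
move=> x /andP[psi0 psi1] m0 hm m2 hpsi; set D : R := (max_total_degree E)%:R.
have D2 : 2 <= D by rewrite ler_nat max_total_degree_ge2.
have hD v : #|[set u | E u v]%SET|%:R <= D by rewrite ler_nat indegree_le_max.
have pip v : 0 < pi v by rewrite (lt_le_trans m0).
have [F [F0 FE Fin Fout gap]] := flow_with_spectral_gap Er pid psi0 psi1 hpsi D2 hD.
have lnD : 2^-1 <= ln (D / psi).
  by rewrite ln_ge_half// ler_pdivlMr// (le_trans _ D2)// ler_piMr.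
have lnm : 2^-1 <= ln m^-1.
  by apply: ln_ge_half; rewrite -[leLHS]invrK lef_pV2 ?posrE ?invr_gt0.
set lam := psi ^+ 2 / _ in gap.
have K0 : 0 < 128 * (168 * ln (D / psi)) by move: lnD; lra.
have psi2 : 0 < psi ^+ 2 <= 1.
  by rewrite exprn_gt0//= exprn_ile1// ltW.
have /andP[psi20 psi21] := psi2.
have lam0 : 0 < lam by rewrite divr_gt0.
have lam1 : lam <= 1.
  by rewrite ler_pdivrMr// mul1r (le_trans psi21)//; move: lnD; lra.
have lam1V : 1 <= lam^-1 by rewrite -invr1 lef_pV2 ?posrE.
pose t := (Num.truncn (4 / lam * (4 + ln m^-1))).+1.
have y0 : 0 <= 4 / lam * (4 + ln m^-1).
  by rewrite mulr_ge0 ?divr_ge0 ?(ltW lam0)//; move: lnm; lra.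
have mix := lazy_mixing_time (M := m^-1) (t := t) Er pid pip F0 FE Fin Fout gap.
apply: le_trans (fastest_mixing_time_le (lazy_chain_admissible Er pip F0 FE Fin Fout)
  (mix _ _ _)) _.
- by rewrite lam0 (le_trans lam1)//; lra.
- by move=> v; rewrite lef_pV2 ?posrE.
- by rewrite ltW// /t truncnS_gt.
rewrite lee_fin; apply: (@le_trans _ _ (4 / lam * (4 + ln m^-1) + 1)).
  by rewrite /t -natr1 lerD2r truncn_le.
rewrite (_ : 38 * _ * _ = 38 * lam^-1 * ln m^-1); last first.
  by rewrite /lam; field; rewrite !gt_eqF//; move: lnD; lra.
have h1 : 0 <= lam^-1 * (ln m^-1 - 2^-1).
  by rewrite mulr_ge0 ?invr_ge0 ?(ltW lam0) ?subr_ge0.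
(* [38 = 32 + 4 + 2]: from [l >= 1/2] and [k >= 1] follow [16 k <= 32 k l] and [1 <= 2 k l]. *)
move: h1 lam1V lnm; set k := lam^-1; set l := ln m^-1; lra.
Qed.

End MixingBounds.

Theorem theorem1p5 (R : realType) :
  exists c1 c2 : R, (0 < c1)%R /\ (0 < c2)%R /\
  forall (V : finType) (E : rel V) (pi : V -> R),
    reflexive E ->
    is_distribution pi ->
    let psi := vertex_expansion E pi in
    let Delta := ((max_total_degree E)%:R)%:E : \bar R in
    let pi_min := min_weight pi in
    let tau_star := fastest_mixing_time E pi in
    (psi^-1 * (lne pi_min^-1)^-1 <= c1%:E * tau_star)%E /\
    (tau_star <= c2%:E * ((psi ^+ 2)^-1 * lne (Delta / psi) * lne pi_min^-1))%E.
Proof.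
(* [32] is the [16] of [mixing_expansion] times the bound 2 on the inverse of the logarithm;
   [128 * 168] comes from the spectral gap and [38] from [fastest_mixing_time_upper]. *)
exists 32, (38 * (128 * 168)); split; first by [].
split; first by rewrite !mulr_gt0.
move=> V E pi Er pid psi Delta pi_min tau_star.
have [pi0 pi1] := pid.
have tau0 : (0 <= tau_star)%E.
  by apply: fastest_mixing_time_ge => P t _ _; rewrite lee_fin.
have rhs0 : (0 <= 32%:E * tau_star)%E by rewrite mule_ge0// lee_fin.
have [[S1 [S1n0 S1T]]|noS] :=
    pselect (exists S : {set V}, S != finset.set0 /\ S \proper finset.setT); last first.
  have noS' (S : {set V}) : S != finset.set0 -> ~~ (S \proper finset.setT).
    by move=> Sn0; apply/negP => ST; apply: noS; exists S.
  (* Here psi is [+oo], so both bounds involve the factor 0. *)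
  rewrite /psi vertex_expansion_trivial// expe2 mulyy !invey !mul0e mule0.
  split => //; exact: fastest_mixing_time_trivial.
have [v0 pi_minE v0min] := min_weight_attained pid.
have [S0 [S0n0 S0T psiE S0min]] := vertex_expansion_attained E pi S1n0 S1T.
rewrite /pi_min pi_minE /psi psiE /Delta.
set r := set_vertex_expansion E pi S0 in psiE S0min *.
set D : R := (max_total_degree E)%:R.
have D2 : 2 <= D by rewrite ler_nat max_total_degree_ge2.
have D0 : 0 < D by lra.
have /andP[r0 r1] : 0 <= r <= 1 by exact: set_vertex_expansion_bounds.
(* A proper cut provides two vertices; this keeps [ln (1 / pi_min)] above [1/2]. *)
have half : pi v0 <= 2^-1.
  have /finset.set0Pn[x xS] := S0n0.
  have [y yS] : exists y, y \notin S0 by have [_ [y _ yS]] := fintype.properP S0T; exists y.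
  have xy : y != x by apply: contraNneq yS => ->.
  have : pi x + pi y <= 1.
    by rewrite -pi1 (bigD1 x)//= lerD2l (bigD1 y)//= lerDl sumr_ge0.
  by have := v0min x; have := v0min y; lra.
have lnD0 : (0 < lne (D%:E / r%:E))%E.
  have [->|r_neq0] := eqVneq r 0.
    by rewrite inve0 gt0_muley; [exact: ltry|rewrite lte_fin].
  have {r_neq0}r0 : 0 < r by rewrite lt_neqAle eq_sym r_neq0.
  rewrite inver gt_eqF// -EFinM lne_EFin; last exact: divr_gt0.
  by rewrite lte_fin ln_gt0// ltr_pdivlMr// mul1r; lra.
have X0 : (0 < ((r%:E ^+ 2)^-1 : \bar R))%E.
  rewrite -EFin_expe inver; case: eqVneq => [_|r2]; first exact: ltry.
  by rewrite lte_fin invr_gt0 lt_neqAle eq_sym r2 sqr_ge0.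
have c2_gt0 : (0 < (38 * (128 * 168))%:E :> \bar R)%E by rewrite lte_fin !mulr_gt0.
(* If [pi_min] is 0, the logarithm is [+oo], the lower bound is 0 and the upper bound [+oo]. *)
have [m0|m_neq0] := eqVneq (pi v0) 0.
  rewrite m0 inve0 /= invey mule0; split => //.
  by rewrite (gt0_muley (mule_gt0 X0 lnD0)) (gt0_muley c2_gt0) leey.
have m_gt0 : 0 < pi v0 by rewrite lt_neqAle eq_sym m_neq0 pi0.
have pip v : 0 < pi v by rewrite (lt_le_trans m_gt0).
have lnm : 2^-1 <= ln (pi v0)^-1.
  by apply: ln_ge_half; rewrite -[leLHS]invrK lef_pV2 ?posrE ?invr_gt0.
have lnm_gt0 : 0 < ln (pi v0)^-1 by rewrite (lt_le_trans _ lnm)// invr_gt0.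
have mixed_ge P t : admissible_transition E pi P ->
    (worst_distance P pi t < (expR 1)^-1%:E)%E -> 16^-1 <= t%:R * r.
  by move=> PE; exact: (mixing_expansion pid PE pip S0n0 S0T).
have -> : (lne (pi v0)%:E^-1 = (ln (pi v0)^-1)%:E)%E.
  by rewrite inver (negbTE m_neq0) lne_EFin ?invr_gt0.
have -> : ((ln (pi v0)^-1)%:E^-1 = ((ln (pi v0)^-1)^-1)%:E :> \bar R)%E.
  by rewrite inver gt_eqF.
(* If psi is 0, [mixed_ge] excludes every finite mixing time. *)
have [rE|r_neq0] := eqVneq r 0.
  have -> : tau_star = +oo%E.
    apply/eqP; rewrite -leye_eq; apply: fastest_mixing_time_ge => P t PE /(mixed_ge _ _ PE).
    by rewrite rE mulr0 [(_ <= 0)%R]leNgt invr_gt0 ltr0n.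
  split; first by rewrite (gt0_muley (x := 32%:E)) ?lte_fin// leey.
  rewrite -EFin_expe {1}rE expr0n inve0 (gt0_mulye lnD0) gt0_mulye ?lte_fin//.
  by rewrite (gt0_muley c2_gt0) leey.
have {r0 r_neq0}r0 : 0 < r by rewrite lt_neqAle eq_sym r_neq0.
rewrite -EFin_expe 2!inver !gt_eqF ?exprn_gt0//.
split.
  apply: (@le_trans _ _ (32%:E * (16^-1 / r)%:E)%E).
    rewrite -!EFinM lee_fin (_ : 32 * (16^-1 / r) = r^-1 * 2); last by field; rewrite gt_eqF.
    rewrite ler_wpM2l ?invr_ge0 ?(ltW r0)// -[leRHS]invrK.
    by rewrite lef_pV2 ?posrE ?invr_gt0.
  rewrite lee_wpmul2l ?lee_fin//; apply: fastest_mixing_time_ge => P t PE.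
  by move=> /(mixed_ge _ _ PE); rewrite lee_fin ler_pdivrMr.
rewrite -EFinM lne_EFin; last exact: divr_gt0.
rewrite -!EFinM.
apply: (fastest_mixing_time_upper Er pid v0 _ m_gt0 v0min half); first by rewrite r0.
exact: vertex_expansionP.
Qed.
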